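(* Let $\phi$ be a 3-SAT formula and let $M'$ be the MAPF instance constructed from $\phi$ as described in the context (three-row grid with variable gadgets, clause gadgets and blocker agents). Then $M'$ has a collision-free motion plan with a distance cost of $d^*(M')$ if and only if $\phi$ is satisfiable.
   Context: A 3-SAT formula is a Boolean formula in conjunctive normal form with three literals in each clause. **MAPF.** A MAPF instance $(G,R,\{s(r),t(r)\}_{r\in R})$ consists of an undirected graph $G=(V,E)$, a set $R$ of agents, and for each $r\in R$ a start vertex $s(r)$ and a target vertex $t(r)$. A trajectory for $r$ is a map $\pi_r:\mathbb N\to V$ ($\mathbb N$ = non-negative integers, time steps) such that $\pi_r(0)=s(r)$; there is $T\in\mathbb N$ with $\pi_r(\tau)=t(r)$ for all $\tau\ge T$; and for all $\tau>0$, $\pi_r(\tau-1)=\pi_r(\tau)$ or $(\pi_r(\tau-1),\pi_r(\tau))\in E$. A motion plan is a family $\{\pi_r\}_{r\in R}$ of trajectories. It is collision-free if for all $r\ne r'$: $\pi_r(\tau)\ne\pi_{r'}(\tau)$ for all $\tau\ge0$, and $(\pi_r(\tau-1),\pi_r(\tau))\ne(\pi_{r'}(\tau),\pi_{r'}(\tau-1))$ for all $\tau>0$. Several agents may move in the same time step. The path of $r$ is $\pi_r$ with consecutive repetitions of a vertex replaced by one occurrence; its length is its number of edges. The distance cost of a motion plan is the sum of the lengths of the agents' paths. $d^*(M')=\sum_{r\in R}d(s(r),t(r))$, where $d(u,v)$ is the length of a shortest path between $u$ and $v$ in $G$. **The instance $M'$.** $G$ is a grid graph with three rows (top, middle, bottom):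 its vertices are the unit cells of a three-row grid that are not obstacles, and side-sharing cells are adjacent. Obstacles make entrances, exits and other passages one row/column wide. From left to right, $G$ consists of a room, one variable gadget for each variable of $\phi$, and one clause gadget for each clause of $\phi$. The order of gadgets of the same type, and of positions within a gadget, is arbitrary. The agents are: one literal agent for each appearance of a literal in $\phi$, one clause agent for each clause, and one blocker agent for each variable gadget. - *Room.* A rectangular room at the far left contains the start cells of all clause agents. There is an order in which the clause agents can leave it one by one along shortest paths without collisions. - *Variable gadgets.* They are placed in series, joined by one-cell-wide passages, and must all be traversed by the clause agents. Each has an entrance cell on the left and an exit cell on the right, and can be traversed from entrance to exit only along two paths, both shortest and both $x$-monotone: the top path (going right along the grid's top row, then down) and the bottom path. The two paths overlap near the entrance and the exit and are otherwise separate. In the gadget of variable $\alpha$, the start cells of the literal agents for appearances of $\alpha$ lie on the top path, and those for appearances of $\overline\alpha$ lie on the bottom path, off the overlap. Each of the two paths also has an initially empty cell, not on the other path, reached from the entrance before any of these start cells. No other literal agents start in the gadget. - *Clause gadgets.* The middle row of the gadget of clause $C$ contains the target cells of the three literal agents of the appearances of literals in $C$, and its top row contains the target cell of the clause agent of $C$. An agent heading to a clause gadget passes the preceding clause gadgets along the bottom row. A shortest path to a literal target goes right along the bottom row to the cell directly below the target and then up. A shortest path of the clause agent of $C$ to its target goes right along the bottom row and must pass up through one of the three literal targets of the gadget, and through each of these three there is such a shortest path. At the right of each clause gadget is an empty column, through which the clause agent's target can be reached, by a longer path, even if all three literal targets are occupied. - *Blockers.* The blocker agent of a variable gadget starts at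 the gadget's entrance and has its target at the gadget's exit. *)

(* Defs.v *)
From HB Require Import structures.
From mathcomp Require Import all_boot.
Set Implicit Arguments.
Unset Strict Implicit.
Unset Printing Implicit Defensive.

(** * Walks, distances *)

(* A walk is given by the full list of its vertices, both ends included, so
   its length (number of edges) is [(size p).-1]. *)
Definition walk (V : finType) (e : rel V) (u v : V) (p : seq V) : bool :=
  if p is x :: q then [&& x == u, path e u q & last u q == v] else false.

(* Length of a shortest walk; the junk value is [#|V|] when there is none. *)
Definition dist (V : finType) (e : rel V) (u v : V) : nat :=
  find (fun l => [exists p : l.+1.-tuple V, walk e u v p]) (iota 0 #|V|).

Definition shortest (V : finType) (e : rel V) (u v : V) (p : seq V) : bool :=
  walk e u v p && ((size p).-1 == dist e u v).

(** * Multi-agent path finding *)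

Record mapf := Mapf {
  vert : finType;
  edge : rel vert;
  edge_sym : symmetric edge;
  agents : finType;
  source : agents -> vert;
  goal : agents -> vert }.

Definition trajectory (M : mapf) (r : agents M) (pi : nat -> vert M) : Prop :=
  [/\ pi 0 = source r,
      exists T, forall tau, T <= tau -> pi tau = goal r
    & forall tau, pi tau = pi tau.+1 \/ edge (pi tau) (pi tau.+1)].

Definition motion_plan (M : mapf) (pi : agents M -> nat -> vert M) : Prop :=
  forall r, trajectory r (pi r).

Definition collision_free (M : mapf) (pi : agents M -> nat -> vert M) : Prop :=
  forall r r' : agents M, r != r' ->
    (forall tau, pi r tau <> pi r' tau) /\
    (forall tau, (pi r tau, pi r tau.+1) <> (pi r' tau.+1, pi r' tau)).

(* Each maximal run of equal consecutive entries is replaced by one entry. *)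
Fixpoint destutter (V : eqType) (s : seq V) : seq V :=
  if s is x :: s' then
    if s' is y :: _ then
      if x == y then destutter s' else x :: destutter s'
    else [:: x]
  else [::].

(* [p] does not depend on the time [T] from which [pi] is constant. *)
Definition path_of (V : eqType) (pi : nat -> V) (p : seq V) : Prop :=
  exists T, (forall tau, T <= tau -> pi tau = pi T) /\
            p = destutter (mkseq pi T.+1).

Definition distance_cost (M : mapf) (pi : agents M -> nat -> vert M)
    (c : nat) : Prop :=
  exists p : agents M -> seq (vert M),
    (forall r, path_of (pi r) (p r)) /\ c = \sum_r (size (p r)).-1.

Definition dstar (M : mapf) : nat :=
  \sum_(r : agents M) dist (@edge M) (source r) (goal r).

(** * 3-SAT *)

(* A literal is a variable with a sign ([true] for the positive literal); the
   literals of a clause need not be distinct. *)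
Record cnf3 := Cnf3 {
  nvar : nat;
  ncl : nat;
  lit : 'I_ncl -> 'I_3 -> 'I_nvar * bool }.

Definition satisfiable (phi : cnf3) : Prop :=
  exists a : 'I_(nvar phi) -> bool,
    forall j : 'I_(ncl phi), exists k : 'I_3, a (lit j k).1 = (lit j k).2.

(** * Agents on a three-row grid *)

(* [Lit j k] is the agent of the [k]-th literal appearance in clause [j]. *)
Inductive agent (phi : cnf3) : Type :=
| Lit of 'I_(ncl phi) & 'I_3
| Cla of 'I_(ncl phi)
| Blk of 'I_(nvar phi).

Definition agent_code (phi : cnf3) (r : agent phi) :
    'I_(ncl phi) * 'I_3 + 'I_(ncl phi) + 'I_(nvar phi) :=
  match r with
  | Lit j k => inl (inl (j, k)) | Cla j => inl (inr j) | Blk x => inr x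
  end.

Definition agent_decode (phi : cnf3)
    (c : 'I_(ncl phi) * 'I_3 + 'I_(ncl phi) + 'I_(nvar phi)) : agent phi :=
  match c with
  | inl (inl (j, k)) => Lit j k | inl (inr j) => Cla j | inr x => Blk x
  end.

Lemma agent_codeK (phi : cnf3) : cancel (@agent_code phi) (@agent_decode phi).
Proof. by case. Qed.

HB.instance Definition _ (phi : cnf3) :=
  Finite.copy (agent phi) (can_type (@agent_codeK phi)).

(* A cell is (row, column); row 0 is the top row and row 2 the bottom row. *)
Definition cell (w : nat) (obst : {set 'I_3 * 'I_w}) : finType :=
  {c : 'I_3 * 'I_w | c \notin obst}.

Definition row (w : nat) (obst : {set 'I_3 * 'I_w}) (v : cell obst) : nat :=
  (val v).1.

Definition col (w : nat) (obst : {set 'I_3 * 'I_w}) (v : cell obst) : nat :=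
  (val v).2.

Definition adj (w : nat) (obst : {set 'I_3 * 'I_w}) : rel (cell obst) :=
  fun u v =>
    (row u == row v) && ((col v == (col u).+1) || (col u == (col v).+1))
    || (col u == col v) && ((row v == (row u).+1) || (row u == (row v).+1)).

Lemma adj_sym (w : nat) (obst : {set 'I_3 * 'I_w}) : symmetric (@adj w obst).
Proof.
move=> u v; rewrite /adj (eq_sym (row u) (row v)) (eq_sym (col u) (col v)).
by rewrite [in RHS]orbC [X in _ = X]orbC; congr (_ && _ || _ && _); rewrite orbC.
Qed.

Record grid (phi : cnf3) := Grid {
  width : nat;
  obstacles : {set 'I_3 * 'I_width};
  start : agent phi -> cell obstacles;
  target : agent phi -> cell obstacles }.

Definition grid_mapf (phi : cnf3) (M : grid phi) : mapf :=
  Mapf (@adj_sym _ (obstacles M)) (@start phi M) (@target phi M).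

(** * The reduction *)

(* [inl x] is the gadget of variable [x], [inr j] that of clause [j]. *)
Definition gadget (phi : cnf3) : Type :=
  ('I_(nvar phi) + 'I_(ncl phi))%type.

Record layout (phi : cnf3) (M : grid phi) := Layout {
  (* the room occupies rows [room_top..room_bot] of columns [0..room_right];
     [door] is its last cell on the way out *)
  room_top : 'I_3;
  room_bot : 'I_3;
  room_right : nat;
  door : cell (obstacles M);
  (* gadget [g] occupies columns [lcol g..rcol g] *)
  lcol : gadget phi -> nat;
  rcol : gadget phi -> nat;
  entrance : 'I_(nvar phi) -> cell (obstacles M);
  exit : 'I_(nvar phi) -> cell (obstacles M);
  (* the overlap of the two paths of a variable gadget near its entrance and
     near its exit *)
  pre : 'I_(nvar phi) -> seq (cell (obstacles M));
  post : 'I_(nvar phi) -> seq (cell (obstacles M));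
  (* the part of the top ([true]) or bottom ([false]) path off the overlap *)
  branch : bool -> 'I_(nvar phi) -> seq (cell (obstacles M)) }.

(* The top ([true]) and the bottom ([false]) path of a variable gadget. *)
Definition through (phi : cnf3) (M : grid phi) (L : layout M) (b : bool)
    (x : 'I_(nvar phi)) : seq (cell (obstacles M)) :=
  pre L x ++ branch L b x ++ post L x.

Definition in_gadget (phi : cnf3) (M : grid phi) (L : layout M)
    (g : gadget phi) (v : cell (obstacles M)) : bool :=
  lcol L g <= col v <= rcol L g.

(* Meant for an x-monotone simple path, where cells of the top row can only be
   followed rightwards and cells of one column only downwards. *)
Definition right_then_down (w : nat) (obst : {set 'I_3 * 'I_w})
    (p : seq (cell obst)) : Prop :=
  exists (u : cell obst) (a d : seq (cell obst)),
    [/\ p = rcons a u ++ d, d != [::],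
        all (fun v => row v == 0) (rcons a u) & all (fun v => col v == col u) d].

(* Exactly one edge leads from column [c] to column [c.+1]. *)
Definition one_wide (w : nat) (obst : {set 'I_3 * 'I_w}) (c : nat) : Prop :=
  #|[set uv : cell obst * cell obst |
      [&& adj uv.1 uv.2, col uv.1 == c & col uv.2 == c.+1]]| = 1.

(* The part of [p] at or to the right of the leftmost clause gadget lies in the
   bottom row. *)
Definition along_bottom (phi : cnf3) (M : grid phi) (L : layout M)
    (p : seq (cell (obstacles M))) : Prop :=
  forall v, v \in p ->
    (exists j : 'I_(ncl phi), lcol L (inr j) <= col v) -> row v = 2.

Record grid_spec (phi : cnf3) (M : grid phi) (L : layout M) : Prop := {
  G_start_inj : injective (@start phi M);
  G_target_inj : injective (@target phi M);
  G_connected : forall u v : cell (obstacles M), connect (@adj _ _) u v;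
  G_gadgets : forall g, lcol L g <= rcol L g;
  G_room_first : forall g, room_right L < lcol L g;
  G_disjoint : forall g h, g != h -> rcol L g < lcol L h \/ rcol L h < lcol L g;
  G_var_clause : forall x j, rcol L (inl x) < lcol L (inr j);
  G_nothing_else : forall v : cell (obstacles M),
    col v <= room_right L \/ exists g, col v <= rcol L g;
  (* between the room and a gadget and between two gadgets *)
  G_passages : forall c,
    room_right L <= c -> (exists g, c < lcol L g) ->
    (forall g, ~~ (lcol L g <= c < rcol L g)) -> one_wide (obstacles M) c }.

Record room_spec (phi : cnf3) (M : grid phi) (L : layout M) : Prop := {
  R_rectangle : forall c : 'I_3 * 'I_(width M), c.2 <= room_right L ->
    (c \notin obstacles M) = (room_top L <= c.1 <= room_bot L);
  R_start : forall j, col (start M (Cla j)) <= room_right L;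
  R_door : col (door L) = room_right L;
  R_leave : forall u v : cell (obstacles M), adj u v ->
    col u = room_right L -> col v = (room_right L).+1 -> u = door L;
  R_order : exists2 o : seq 'I_(ncl phi),
    perm_eq o (enum 'I_(ncl phi)) &
    forall j, exists2 p, shortest (@adj _ _) (start M (Cla j)) (door L) p &
      forall j', index j o < index j' o -> start M (Cla j') \notin p }.

Record var_spec (phi : cnf3) (M : grid phi) (L : layout M)
    (x : 'I_(nvar phi)) : Prop := {
  V_entrance : col (entrance L x) = lcol L (inl x);
  V_exit : col (exit L x) = rcol L (inl x);
  V_enter : forall u v : cell (obstacles M), adj u v ->
    (col u).+1 = lcol L (inl x) -> col v = lcol L (inl x) -> v = entrance L x;
  V_leave : forall u v : cell (obstacles M), adj u v ->
    col u = rcol L (inl x) -> col v = (rcol L (inl x)).+1 -> u = exit L x;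
  V_shortest : forall b,
    shortest (@adj _ _) (entrance L x) (exit L x) (through L b x);
  V_xmonotone : forall b, sorted leq (map (@col _ _) (through L b x));
  V_only : forall p, walk (@adj _ _) (entrance L x) (exit L x) p -> uniq p ->
    exists b, p = through L b x;
  V_pre : entrance L x \in pre L x;
  V_post : exit L x \in post L x;
  V_separate : forall v, v \in branch L true x -> v \notin branch L false x;
  (* [take 1 (post L x)] is the cell where the top path joins the overlap *)
  V_top : right_then_down (branch L true x ++ take 1 (post L x));
  V_literals : forall j k, (lit j k).1 = x ->
    start M (Lit j k) \in branch L (lit j k).2 x;
  V_empty : forall b, exists v : cell (obstacles M),
    [/\ v \in branch L b x,
        forall r : agent phi, start M r != v
      & forall j k, lit j k = (x, b) ->
          index v (through L b x) < index (start M (Lit j k)) (through L b x)];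
  V_blocker_start : start M (Blk x) = entrance L x;
  V_blocker_target : target M (Blk x) = exit L x }.

Record clause_spec (phi : cnf3) (M : grid phi) (L : layout M)
    (j : 'I_(ncl phi)) : Prop := {
  C_lit_target : forall k,
    in_gadget L (inr j) (target M (Lit j k)) /\ row (target M (Lit j k)) = 1;
  C_cla_target :
    in_gadget L (inr j) (target M (Cla j)) /\ row (target M (Cla j)) = 0;
  C_lit_path : forall k p,
    shortest (@adj _ _) (start M (Lit j k)) (target M (Lit j k)) p ->
    exists q u, [/\ p = rcons (rcons q u) (target M (Lit j k)),
      along_bottom L (rcons q u),
      row u = 2 & col u = col (target M (Lit j k))];
  C_cla_path : forall p,
    shortest (@adj _ _) (start M (Cla j)) (target M (Cla j)) p ->
    exists k q u u' q', [/\ p = rcons q u ++ target M (Lit j k) :: u' :: q',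
      along_bottom L (rcons q u),
      row u = 2 /\ col u = col (target M (Lit j k)),
      col u' = col (target M (Lit j k))
    & all (fun v => row v == 0) (u' :: q')];
  C_cla_any : forall k, exists2 p,
    shortest (@adj _ _) (start M (Cla j)) (target M (Cla j)) p &
    target M (Lit j k) \in p;
  C_column : forall i : 'I_3, exists v : cell (obstacles M),
    [/\ row v = i, col v = rcol L (inr j)
      & forall r : agent phi, start M r != v /\ target M r != v];
  (* the way to the target of the clause agent that uses the empty column *)
  C_detour : exists2 p,
    walk (@adj _ _) (start M (Cla j)) (target M (Cla j)) p &
    [/\ dist (@adj _ _) (start M (Cla j)) (target M (Cla j)) < (size p).-1,
        forall k, target M (Lit j k) \notin p
      & forall v : cell (obstacles M), col v = rcol L (inr j) -> v \in p] }.

Definition reduction (phi : cnf3) (M : grid phi) (L : layout M) : Prop :=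
  [/\ grid_spec L, room_spec L,
      forall x, var_spec L x & forall j, clause_spec L j].

(* Main.v *)
(* A motion plan of cost [dstar] moves every agent along a shortest path.  An
   agent cannot overtake another one while both follow the same route, so
   everything that traverses a variable gadget, after its blocker has left the
   entrance and before the blocker parks at the exit, takes the branch opposite
   to that of the blocker; read the assignment off the branches of the blockers.
   If the literal whose target the clause agent crosses were false, the clause
   agent would follow the literal agent on the whole route of the latter, and
   could only reach that target after it has been occupied for good.

   Conversely, given a satisfying assignment, each blocker withdraws to the free
   cell of the branch of the true literals.  Then the agents move one at a time,
   through the other branches: first the false literals (the front-most first),
   then the clause agents, each through the target of a true literal, then the
   true literals, and finally the blockers. *)

Require Import Defs.
From mathcomp Require Import all_boot zify.
Set Implicit Arguments.
Unset Strict Implicit.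
Unset Printing Implicit Defensive.

(** * Walks and shortest paths *)

Section Walks.
Context (V : finType) (e : rel V).
Implicit Types (u v w z : V) (p q m : seq V).

Lemma walk_head u v p : walk e u v p -> p = u :: behead p.
Proof. by case: p => //= x p /andP[/eqP->]. Qed.

Lemma walk_last u v p d : walk e u v p -> last d p = v.
Proof. by case: p => //= x p /and3P[/eqP-> _ /eqP]. Qed.

Lemma walk_belast u v p : walk e u v p -> exists q, p = rcons q v.
Proof.
case: p => //= x p /and3P[/eqP-> _ /eqP<-].
by exists (belast u p); rewrite -lastI.
Qed.

Lemma walk_mem_head u v p : walk e u v p -> u \in p.
Proof. by move=> /walk_head ->; rewrite mem_head. Qed.

Lemma walk_mem_last u v p : walk e u v p -> v \in p.
Proof. by case/walk_belast => q ->; rewrite mem_rcons mem_head. Qed.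

(** Only the ends of [m] enter the right-hand side, so one segment can be exchanged for another with
    the same ends. *)
Lemma walk_mid u v z w p m q : walk e z w m ->
  walk e u v (p ++ m ++ q) = walk e u z (rcons p z) && walk e w v (w :: q).
Proof.
case: m => // _ m /and3P[/eqP-> zm /eqP lm].
case: p => [|x p] /=.
  case: (z =P u) => [<-|] //=.
  by rewrite cat_path last_cat lm zm !eqxx.
rewrite rcons_path last_rcons cat_path last_cat /= cat_path last_cat lm zm !eqxx.
by case: (x == u) => //=; rewrite -!andbA.
Qed.

Lemma walk_split u v z p q :
  walk e u v (p ++ z :: q) = walk e u z (rcons p z) && walk e z v (z :: q).
Proof.
have zz : walk e z z [:: z] by rewrite /= !eqxx.
by rewrite -(walk_mid u v p q zz).
Qed.

Lemma walk_take u v z p q : walk e u v (p ++ z :: q) -> walk e u z (rcons p z).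
Proof. by rewrite walk_split => /andP[]. Qed.

Lemma walk_drop u v z p q : walk e u v (p ++ z :: q) -> walk e z v (z :: q).
Proof. by rewrite walk_split => /andP[]. Qed.

Lemma walk_infix u v z p m q : walk e u v (p ++ (z :: m) ++ q) ->
  walk e z (last z m) (z :: m).
Proof.
rewrite walk_split => /andP[_]; rewrite -cat_cons.
case/lastP: m => [|m w]; first by rewrite /= !eqxx.
by rewrite -cats1 -cat_cons -catA => /walk_take; rewrite last_cat cats1.
Qed.

Lemma walk_replace u v z w p m m' q : walk e z w m -> walk e z w m' ->
  walk e u v (p ++ m ++ q) -> walk e u v (p ++ m' ++ q).
Proof. by move=> h h'; rewrite (walk_mid _ _ _ _ h) (walk_mid _ _ _ _ h'). Qed.

Lemma walk_edge u v x y p q : walk e u v (p ++ x :: y :: q) -> e x y.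
Proof. by move/walk_drop => /= /and3P[_ /andP[]]. Qed.

Lemma walk_connect u v p : walk e u v p -> connect e u v.
Proof.
case: p => // x p /and3P[_ up /eqP <-].
by apply/connectP; exists p.
Qed.

Lemma dist_le u v p : walk e u v p -> dist e u v <= (size p).-1.
Proof.
move=> uvp; rewrite /dist; set a := (fun l => _).
(* A walk of at least [#|V|] edges is no shorter than any value of the search, the junk value
   included. *)
case: (ltnP (size p).-1 #|V|) => [lt|]; last first.
  by apply: leq_trans; rewrite -[X in _ <= X](size_iota 0) find_size.
rewrite leqNgt; apply/negP => /(before_find 0); rewrite nth_iota // add0n.
move/negbT/negP; apply; apply/existsP.
have sp : size p == (size p).-1.+1 by case: p uvp {lt}.
by exists (Tuple sp).
Qed.

Lemma dist_walk u v : connect e u v -> exists p, shortest e u v p.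
Proof.
(* Without repetitions a walk has at most [#|V|] vertices, so the bounded search in [dist]
   succeeds. *)
case/connectP => p0 /shortenP[p up Up _] ->.
have: has (fun l => [exists p' : l.+1.-tuple V, walk e u (last u p) p'])
  (iota 0 #|V|).
  apply/hasP; exists (size p); last first.
    apply/existsP; exists (in_tuple (u :: p)).
    by rewrite /= eqxx up eqxx.
  rewrite mem_iota add0n /=.
  by rewrite -[(size p).+1]/(size (u :: p)) -(card_uniqP Up) max_card.
move=> h; have := nth_find 0 h; move: h; rewrite has_find size_iota => lt.
rewrite nth_iota // add0n => /existsP[q uq].
by exists (tval q); apply/andP; split; [exact: uq | rewrite size_tuple /dist].
Qed.

Lemma shortestP u v p : reflect
  (walk e u v p /\ forall q, walk e u v q -> size p <= size q) (shortest e u v p).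
Proof.
apply: (iffP andP) => [[uvp /eqP sp]|[uvp minp]].
  split=> // q uvq; have := dist_le uvq; rewrite -sp.
  by case: (p) (q) uvp uvq => [|? ?] [|? ?].
split=> //; rewrite eqn_leq dist_le // andbT.
have [q /andP[uvq /eqP <-]] := dist_walk (walk_connect uvp).
by have := minp _ uvq; lia.
Qed.

Lemma shortest_walk u v p : shortest e u v p -> walk e u v p.
Proof. by case/andP. Qed.

Lemma shortest_size u v p : shortest e u v p -> size p = (dist e u v).+1.
Proof. by case/andP => + /eqP <-; case: p. Qed.

(** Cutting out loops gives a walk on a subset of the vertices, and minimality leaves nothing to
    cut. *)
Lemma shortest_uniq u v p : shortest e u v p -> uniq p.
Proof.
case/shortestP; case: p => // x p /and3P[/eqP-> up /eqP lp] minp.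
case: (shortenP up) lp => q uq Uq sub_qp lq.
have Sq : size p <= size q by apply: (minp (u :: q)); rewrite /= eqxx uq lq eqxx.
rewrite cons_uniq in Uq; case/andP: Uq => uNq Uq.
have [/= sz eqp] := uniq_min_size Uq sub_qp Sq.
by rewrite -(eq_uniq sz eqp) -eqp uNq Uq.
Qed.

Lemma shortest_infix u v z w p m q : walk e z w m ->
  shortest e u v (p ++ m ++ q) -> shortest e z w m.
Proof.
move=> zwm /shortestP[uvp minp]; apply/shortestP; split=> // m' zwm'.
by have := minp _ (walk_replace zwm zwm' uvp); rewrite !size_cat; lia.
Qed.

Lemma shortest_take u v z p q :
  shortest e u v (p ++ z :: q) -> shortest e u z (rcons p z).
Proof.
move=> h; apply: (@shortest_infix u v u z [::] (rcons p z) q).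
  exact: walk_take (shortest_walk h).
by rewrite cat0s cat_rcons.
Qed.

Lemma shortest_drop u v z p q :
  shortest e u v (p ++ z :: q) -> shortest e z v (z :: q).
Proof.
move=> h; apply: (@shortest_infix u v z v p (z :: q) [::]).
  exact: walk_drop (shortest_walk h).
by rewrite cats0.
Qed.

Lemma shortest_replace u v z w p m m' q : walk e z w m -> shortest e z w m' ->
  shortest e u v (p ++ m ++ q) -> shortest e u v (p ++ m' ++ q).
Proof.
move=> zwm /shortestP[zwm' minm'] /shortestP[uvp minp].
apply/shortestP; split; first exact: walk_replace zwm zwm' uvp.
move=> p' /minp; have := minm' _ zwm; rewrite !size_cat; lia.
Qed.

Lemma shortest_dist_nth u v p d i : shortest e u v p -> i < size p ->
  dist e u (nth d p i) = i.
Proof.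
move=> sp lt; have := sp; rewrite -{1}(cat_take_drop i p) (drop_nth d lt).
by move/shortest_take/shortest_size; rewrite size_rcons size_take lt => -[].
Qed.

(** The position of a vertex on a shortest walk is its distance from [u], so a common vertex has the
    same index on both walks. *)
Lemma shortest_sub_eq u v p q : shortest e u v p -> shortest e u v q ->
  {subset p <= q} -> p = q.
Proof.
move=> sp sq sub.
have spq : size p = size q by rewrite (shortest_size sp) (shortest_size sq).
apply: (@eq_from_nth _ u) => // i ltp.
have /(nthP u)[j ltj eqj] := sub _ (mem_nth u ltp).
rewrite -eqj; congr nth.
by rewrite -(shortest_dist_nth u sp ltp) -eqj (shortest_dist_nth u sq ltj).
Qed.

End Walks.

(** * Sequences and walks along a line *)

Lemma line_mem (a : nat) (s : seq nat) (z : nat) :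
  path (fun i j => (j == i.+1) || (i == j.+1)) a s -> uniq (a :: s) ->
  (z \in a :: s) = (minn a (last a s) <= z <= maxn a (last a s)).
Proof.
elim: s a z => [|b s IH] a z; first by move=> _ _; rewrite inE /=; lia.
rewrite [path _ _ _]/= [uniq _]/= => /andP[ab bs] /andP[aNs Us].
have {}IH z' := IH b z' bs Us.
(* The tail fills an interval with end [b]; [a] is adjacent to [b] and outside this interval, hence
   extends it by one. *)
rewrite in_cons IH [last a _]/=; move: aNs; rewrite IH; lia.
Qed.

Lemma first_exit (T : Type) (P : pred T) (a : T) (s : seq T) : P a ->
  all P (a :: s) \/ exists s1 x y s2,
    [/\ a :: s = rcons s1 x ++ y :: s2, all P (rcons s1 x) & ~~ P y].
Proof.
elim: s a => [|b s IH] a Pa; first by left; rewrite /= Pa.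
case Pb: (P b); last first.
  by right; exists [::], a, b, s; rewrite /= Pa Pb.
case: (IH b Pb) => [h|[s1 [x [y [s2 [-> Ps1 Py]]]]]].
  by left; rewrite /= Pa.
by right; exists (a :: s1), x, y, s2; rewrite /= Pa.
Qed.

Lemma uniq_split_inj (T : eqType) (t : T) (a a' r r' : seq T) :
  uniq (a ++ t :: r) -> a ++ t :: r = a' ++ t :: r' -> a = a' /\ r = r'.
Proof.
elim: a a' => [|x a IH] [|x' a'] //=.
- by move=> _ [].
- by case/andP=> tNr _ [_ Er]; rewrite Er mem_cat mem_head orbT in tNr.
- by case/andP=> xN _ [Ex _]; rewrite Ex mem_cat mem_head orbT in xN.
- by case/andP=> _ U [-> /(IH _ U) [-> ->]].
Qed.

Lemma index_drop_mem (T : eqType) (s : seq T) (u v : T) : uniq s ->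
  u \in drop (index v s) s -> index v s <= index u s.
Proof.
move=> Us ud; rewrite leqNgt; apply/negP => lt.
move: Us; rewrite -{1}(cat_take_drop (index v s) s) cat_uniq => /and3P[_ /hasPn/(_ u ud) + _].
by rewrite /= in_take_leq ?index_size // lt.
Qed.

Lemma mem_cat3 (T : eqType) (p1 p2 p3 : seq T) z :
  (z \in p1 ++ p2 ++ p3) = [|| z \in p1, z \in p2 | z \in p3].
Proof. by rewrite !mem_cat. Qed.

(** The coordinates [f] and [g] serve as column and row or the other way round. Where [f] is
    constant, a simple walk changes [g] by one per step without turning back, and so fills an
    interval. *)
Lemma line_cells (V : finType) (e : rel V) (f g : V -> nat) (a b : V) (p : seq V) :
  (forall u v, f u = f v -> g u = g v -> u = v) ->
  (forall u v, e u v -> f u = f v -> (g v == (g u).+1) || (g u == (g v).+1)) ->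
  walk e a b p -> uniq p -> (forall z, z \in p -> f z = f a) ->
  forall z, (z \in p) =
    (f z == f a) && (minn (g a) (g b) <= g z <= maxn (g a) (g b)).
Proof.
move=> inj_fg step; case: p => // _ s /and3P[/eqP-> as_ /eqP <-] Us fs z.
have inj_g : {in a :: s &, injective g}.
  by move=> u v /fs fu /fs fv; apply: inj_fg; rewrite fu fv.
have pg : path (fun i j => (j == i.+1) || (i == j.+1)) (g a) (map g s).
  have fs' z' : z' \in s -> f z' = f a by move=> z's; apply: fs; rewrite inE z's orbT.
  have pg a' : f a' = f a -> path e a' s ->
    path (fun i j => (j == i.+1) || (i == j.+1)) (g a') (map g s).
    elim: s fs' {as_ Us inj_g fs} a' => //= b' s IH fs a' fa' /andP[ab bs].
    have fb : f b' = f a by apply: fs; rewrite mem_head.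
    rewrite step ?fb ?fa' //=; apply: IH => // z' z's.
    by apply: fs; rewrite inE z's orbT.
  exact: pg (erefl _) as_.
rewrite -(last_map g) -(line_mem _ pg) -?map_cons ?map_inj_in_uniq //.
apply/idP/andP => [zs|[/eqP fz /mapP[z' z's gz]]]; last first.
  by rewrite (inj_fg z z') // fz fs.
by rewrite fs // eqxx map_f.
Qed.

(** * Walks on a grid *)

Section Grid.
Context (w : nat) (obst : {set 'I_3 * 'I_w}).
Local Notation V := (cell obst).
Local Notation e := (@adj w obst).
Implicit Types (u v x y z : V) (p q : seq V).

Lemma cell_inj u v : row u = row v -> col u = col v -> u = v.
Proof.
case: u v => [[r c] h] [[r' c'] h'] eqr eqc; apply: val_inj => /=.
by congr (_, _); apply: val_inj.
Qed.

Lemma adj_col u v : e u v -> col u <= (col v).+1 /\ col v <= (col u).+1.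
Proof. rewrite /adj; lia. Qed.

Lemma adj_same_col u v : e u v -> col u = col v ->
  (row v == (row u).+1) || (row u == (row v).+1).
Proof. rewrite /adj; lia. Qed.

Lemma adj_same_row u v : e u v -> row u = row v ->
  (col v == (col u).+1) || (col u == (col v).+1).
Proof. rewrite /adj; lia. Qed.

Lemma one_wide_edge c u v u' v' : one_wide obst c ->
  e u v -> col u = c -> col v = c.+1 ->
  e u' v' -> col u' = c -> col v' = c.+1 -> u = u' /\ v = v'.
Proof.
move=> /eqP/cards1P[[a b] Eab] uv uc vc uv' uc' vc'.
have in_ab u1 v1 : e u1 v1 -> col u1 = c -> col v1 = c.+1 -> (u1, v1) = (a, b).
  move=> h1 h2 h3; apply/set1P; rewrite -Eab inE /=.
  by rewrite h1 h2 h3 !eqxx.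
have [-> ->] := in_ab _ _ uv uc vc.
by have [-> ->] := in_ab _ _ uv' uc' vc'.
Qed.

(** A walk that came back over the cut would use its only edge in reverse and visit [x] twice. *)
Lemma cut_walk c u v p : one_wide obst c -> walk e u v p -> uniq p ->
  col u <= c < col v ->
  exists p1 x y p2, [/\ p = rcons p1 x ++ y :: p2, e x y, col x = c /\ col y = c.+1,
    forall z, z \in rcons p1 x -> col z <= c &
    forall z, z \in y :: p2 -> c < col z].
Proof.
move=> wide uvp Up /andP[uc vc].
have [] := @first_exit _ (fun z => col z <= c) u (behead p) uc;
  rewrite -(walk_head uvp).
  by move=> /allP/(_ _ (walk_mem_last uvp)); lia.
case=> p1 [x [y [p2 [Ep /allP p1c]]]]; rewrite -ltnNge => yc.
have xy : e x y by move: uvp; rewrite Ep cat_rcons => /walk_edge.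
have xc : col x <= c by apply: p1c; rewrite mem_rcons mem_head.
have [/= cx cy] : col x = c /\ col y = c.+1 by have := adj_col xy; lia.
exists p1, x, y, p2; split=> //.
have [/allP //|] := @first_exit _ (fun z => c < col z) y p2 yc.
case=> q1 [x' [y' [q2 [Eq /allP q1c]]]]; rewrite -leqNgt => yc'.
have xy' : e x' y'.
  move: uvp; rewrite Ep Eq cat_rcons => /walk_drop.
  by rewrite -cat_cons -rcons_cons cat_rcons => /walk_edge.
have xc' : c < col x' by apply: q1c; rewrite mem_rcons mem_head.
have [cx' cy'] : col x' = c.+1 /\ col y' = c by have := adj_col xy'; lia.
have [Eyx _] : x = y' /\ y = x'.
  by apply: (one_wide_edge wide xy cx cy _ cy' cx'); rewrite adj_sym.
move: Up; rewrite Ep Eq cat_uniq => /and3P[_ /hasPn/(_ y')].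
by rewrite mem_cat mem_head orbT -Eyx mem_rcons mem_head => /(_ isT).
Qed.

End Grid.

(** * Shortest paths through the gadgets *)

Section Layout.
Context (phi : cnf3) (M : grid phi) (L : layout M) (red : reduction L).
Local Notation V := (cell (obstacles M)).
Local Notation e := (@adj (width M) (obstacles M)).
Implicit Types (u v z : V) (p q : seq V) (x y : 'I_(nvar phi)) (b c : bool)
  (g h : gadget phi) (j : 'I_(ncl phi)) (k : 'I_3).

Let G : grid_spec L. Proof. by case: red. Qed.
Let R : room_spec L. Proof. by case: red. Qed.
Let VS x : var_spec L x. Proof. by case: red. Qed.
Let CS j : clause_spec L j. Proof. by case: red. Qed.

Lemma gadgets_apart g h (c : nat) : lcol L g <= c <= rcol L g -> lcol L h <= c <= rcol L h ->
  g = h.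
Proof. by move=> gc hc; apply/eqP/negPn/negP => /(G_disjoint G); lia. Qed.

Lemma gadget_right g h (c : nat) :
  rcol L g < c -> lcol L h <= c <= rcol L h -> rcol L g < lcol L h.
Proof.
move=> gc hc; have := G_gadgets G g; have := G_gadgets G h.
case: (altP (g =P h)) => [E|/(G_disjoint G)]; last lia.
by rewrite E in gc; lia.
Qed.

Lemma one_wide_before g (c : nat) : c.+1 = lcol L g -> one_wide (obstacles M) c.
Proof.
move=> Ec; have rg := G_room_first G g; have lg := G_gadgets G g.
apply: (G_passages G); [lia | by exists g; lia | move=> h].
have lh := G_gadgets G h.
apply/negP => hc; case: (altP (g =P h)) => [E|/(G_disjoint G)]; last lia.
by rewrite E in Ec; lia.
Qed.

(** The cell [v] shows that [g] is not the last gadget; a column is known to be a passage only if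
    some gadget follows it. *)
Lemma one_wide_after g v : rcol L g < col v -> one_wide (obstacles M) (rcol L g).
Proof.
move=> gv; have rg := G_room_first G g; have lg := G_gadgets G g.
have [h gh] : exists h, rcol L g < lcol L h.
  case: (G_nothing_else G v) => [|[h vh]]; first lia.
  exists h; have lh := G_gadgets G h.
  case: (altP (g =P h)) => [E|/(G_disjoint G)]; last lia.
  by rewrite E in gv; lia.
apply: (G_passages G); [lia | by exists h | move=> f].
apply/negP => hc; case: (altP (g =P f)) => [E|/(G_disjoint G)]; last lia.
by rewrite E in hc; lia.
Qed.

Lemma one_wide_gap g (c : nat) : room_right L < c.+1 < lcol L g ->
  (forall h, ~~ (lcol L h <= c.+1 <= rcol L h)) ->
  one_wide (obstacles M) c /\ one_wide (obstacles M) c.+1.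
Proof.
move=> /andP[rc cg] gap; split; apply: (G_passages G) => //.
- by exists g; apply: ltnW.
- by move=> h; have := gap h; lia.
- exact: ltnW.
- by exists g.
- by move=> h; have := gap h; lia.
Qed.

Lemma one_wide_room g : one_wide (obstacles M) (room_right L).
Proof.
apply: (G_passages G) => //; first by exists g; exact: G_room_first.
by move=> h; have := G_room_first G h; lia.
Qed.

Lemma through_shortest b x : shortest e (entrance L x) (exit L x) (through L b x).
Proof. exact: V_shortest (VS x) b. Qed.

(** By x-monotonicity the columns stay between those of the entrance and the exit. *)
Lemma through_in_gadget b x v : v \in through L b x -> in_gadget L (inl x) v.
Proof.
have [w1 _] := andP (through_shortest b x).
have := V_xmonotone (VS x) b; move: w1 => /[swap] srt w1 vt.
have mono := sorted_leq_nth leq_trans leqnn 0 srt.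
have sz : 0 < size (through L b x) by move: vt; case: (through L b x).
have := walk_last v w1; rewrite -nth_last => Elast.
have := congr1 (head v) (walk_head w1); rewrite /= -nth0 => Ehead.
move/(nthP v): vt => [i lti <-]; rewrite /in_gadget -(V_entrance (VS x)).
rewrite -(V_exit (VS x)) -{1}Ehead -Elast -!(nth_map v 0) ?prednK //.
by rewrite !mono ?inE ?size_map ?prednK // -ltnS prednK.
Qed.

(** Each path is simple, which keeps its branch off the overlap, and the two branches are disjoint
    by [V_separate]. *)
Lemma branch_through b c x v : v \in branch L b x ->
  (v \in through L c x) = (b == c).
Proof.
move=> vb; have := shortest_uniq (through_shortest b x).
rewrite /through !mem_cat cat_uniq => /and3P[_ /hasPn pb].
rewrite cat_uniq => /and3P[_ /hasPn pp _].
have vNpre : v \notin pre L x by apply: pb; rewrite mem_cat vb.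
have vNpost : v \notin post L x by apply/negP => /pp; rewrite vb.
rewrite (negPf vNpre) (negPf vNpost) orbF /=.
case: b c vb {pb pp} => [] [] //= vb.
  by rewrite (negPf (V_separate (VS x) vb)).
by apply/negP => /(V_separate (VS x)); rewrite vb.
Qed.

Lemma branch_in_gadget b x v : v \in branch L b x -> in_gadget L (inl x) v.
Proof.
by move=> vb; apply: (@through_in_gadget b); rewrite (branch_through _ vb) eqxx.
Qed.

Lemma entrance_col x : col (entrance L x) = lcol L (inl x).
Proof. exact: V_entrance. Qed.

Lemma exit_col x : col (exit L x) = rcol L (inl x).
Proof. exact: V_exit. Qed.

(** The walk crosses each of the two cuts bounding the gadget once, at the entrance and at the exit.
    Its middle part is simple, hence one of the two paths by [V_only]. *)
Lemma gadget_split x u v p : walk e u v p -> uniq p ->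
  col u < lcol L (inl x) -> rcol L (inl x) < col v ->
  exists b p1 p2, [/\ p = p1 ++ through L b x ++ p2,
    forall z, z \in p1 -> col z < lcol L (inl x) &
    forall z, z \in p2 -> rcol L (inl x) < col z].
Proof.
move=> uvp Up ux xv; have lr := G_gadgets G (inl x).
have Ec : (lcol L (inl x)).-1.+1 = lcol L (inl x) by lia.
have [|p1 [z1 [z2 [p2 [Ep z12 [cz1 cz2] h1 _]]]]] :=
  cut_walk (one_wide_before Ec) uvp Up; first lia.
have Ez2 : z2 = entrance L x by apply: (V_enter (VS x) z12); lia.
subst z2; rewrite Ep in uvp Up; have wEv := walk_drop uvp.
move: (Up); rewrite cat_uniq => /and3P[_ _ UEv].
have [|q1 [y1 [y2 [q2 [Eq y12 [cy1 cy2] h3 h4]]]]] :=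
  cut_walk (one_wide_after xv) wEv UEv; first by rewrite entrance_col lr xv.
have Ey1 : y1 = exit L x by apply: (V_leave (VS x) y12).
subst y1; rewrite Eq cat_rcons in wEv; have wEE := walk_take wEv.
have UEE : uniq (rcons q1 (exit L x)).
  by move: UEv; rewrite Eq cat_uniq => /andP[].
have [b Eb] := V_only (VS x) wEE UEE.
exists b, (rcons p1 z1), (y2 :: q2); split=> //; first by rewrite Ep Eq Eb.
by move=> z /h1; lia.
Qed.

(** Grafting the stretch from [s] to the exit onto the beginning of the path of branch [b] gives a
    shortest way through the gadget. By [V_only] it is one of the two paths, and [s] lies on only
    one of them. *)
Lemma gadget_suffix b x s v p : shortest e s v p ->
  s \in branch L b x -> rcol L (inl x) < col v ->
  exists2 p2, p = drop (index s (through L b x)) (through L b x) ++ p2 &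
    forall z, z \in p2 -> rcol L (inl x) < col z.
Proof.
move=> sp sb xv; have /andP[ls sr] := branch_in_gadget sb.
have [|p1 [z1 [z2 [p2 [Ep z12 [cz1 cz2] h1 h2]]]]] :=
  cut_walk (one_wide_after xv) (shortest_walk sp) (shortest_uniq sp).
  by rewrite sr xv.
have Ez1 : z1 = exit L x by apply: (V_leave (VS x) z12).
subst z1; exists (z2 :: p2) => //; rewrite Ep; congr (_ ++ _).
have sE : shortest e s (exit L x) (rcons p1 (exit L x)).
  by move: sp; rewrite Ep cat_rcons => /shortest_take.
have st : s \in through L b x by rewrite (branch_through _ sb) eqxx.
have := through_shortest b x; set T := through L b x in st *.
move=> sT; have Esplit : T = take (index s T) T ++ drop (index s T) T ++ [::].
  by rewrite cats0 cat_take_drop.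
have wd : walk e s (exit L x) (drop (index s T) T).
  move: (shortest_walk sT); rewrite {1}Esplit cats0 (drop_nth s) ?index_mem //.
  by rewrite nth_index // => /walk_drop.
have := sT; rewrite {1}Esplit => /(shortest_replace wd sE).
rewrite cats0 => sN.
have [c Ec] := V_only (VS x) (shortest_walk sN) (shortest_uniq sN).
have : s \in through L c x by rewrite -Ec mem_cat (walk_mem_head (shortest_walk sE)) orbT.
rewrite (branch_through _ sb) => /eqP bc; move: Ec; rewrite -bc -/T.
by rewrite -[in RHS](cat_take_drop (index s T) T) => /eqP; rewrite eqseq_cat // eqxx => /eqP.
Qed.

(** Gadget by gadget, the path taken is exchanged for the chosen one, which is equally short. The
    last condition carries facts about the room, the gaps and the clause gadgets over to the new
    walk. *)
Lemma reroute (c : 'I_(nvar phi) -> bool) u v p : shortest e u v p ->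
  exists p', [/\ shortest e u v p',
    forall y z, col u < lcol L (inl y) -> rcol L (inl y) < col v ->
      z \in p' -> in_gadget L (inl y) z -> z \in through L (c y) y &
    forall z, (forall y, ~~ in_gadget L (inl y) z) -> (z \in p') = (z \in p)].
Proof.
move=> sp; suff [p' [sp' h1 h2]] : exists p', [/\ shortest e u v p',
    forall y z, y \in enum 'I_(nvar phi) ->
      col u < lcol L (inl y) -> rcol L (inl y) < col v ->
      z \in p' -> in_gadget L (inl y) z -> z \in through L (c y) y &
    forall z, (forall y, ~~ in_gadget L (inl y) z) -> (z \in p') = (z \in p)].
  by exists p'; split=> // y z; apply: h1; rewrite mem_enum.
elim: (enum _) => [|y ys [q [sq h1 h2]]]; first by exists p.
case: (boolP ((col u < lcol L (inl y)) && (rcol L (inl y) < col v))); last first.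
  move=> /negP N; exists q; split=> // y' z; rewrite inE => /predU1P[->|]; last exact: h1.
  by move=> *; case: N; apply/andP.
case/andP=> uy yv.
have [b [p1 [p2 [Eq p1y p2y]]]] :=
  gadget_split (shortest_walk sq) (shortest_uniq sq) uy yv.
exists (p1 ++ through L (c y) y ++ p2); split.
- rewrite Eq in sq; apply: shortest_replace sq; last exact: through_shortest.
  exact: shortest_walk (through_shortest b y).
- move=> y' z y'in uy' y'v; rewrite mem_cat3 => zin zg.
  have [E|ne] := altP (y' =P y).
    subst y'; case/or3P: zin => // [/p1y|/p2y]; move: zg; rewrite /in_gadget; lia.
  apply: h1 => //; first by move: y'in; rewrite inE (negPf ne).
  rewrite Eq mem_cat3; case/or3P: zin => [->|zt|->]; rewrite ?orbT //.
  have /eqP[] : inl y' == inl y :> gadget phi; last by move=> E; rewrite E eqxx in ne.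
  by apply/eqP; apply: gadgets_apart zg (through_in_gadget zt).
- move=> z zN; rewrite -(h2 z zN) Eq !(mem_cat3 p1 _ p2); congr (_ || (_ || _)).
  by apply/idP/idP => /through_in_gadget; rewrite (negPf (zN y)).
Qed.

(** The single crossings into and out of column [c.+1] fix the first and the last cell there; in
    between the walk is a simple vertical segment. *)
Lemma gap_part (c : nat) u v p : one_wide (obstacles M) c -> one_wide (obstacles M) c.+1 ->
  walk e u v p -> uniq p -> col u <= c -> c.+1 < col v ->
  exists x1 x2 y1 y2 : V, [/\ e x1 x2, e y1 y2, col x1 = c /\ col x2 = c.+1,
     col y1 = c.+1 /\ col y2 = c.+2 &
     forall z, col z = c.+1 ->
       (z \in p) = (minn (row x2) (row y1) <= row z <= maxn (row x2) (row y1))].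
Proof.
move=> W1 W2 wp Up uc cv.
have [|q1 [x1 [x2 [q2 [Eq x12 cx h1 h2]]]]] := cut_walk W1 wp Up.
  by rewrite uc (ltn_trans _ cv).
rewrite Eq in wp Up; have w2 := walk_drop wp.
move: Up; rewrite cat_uniq => /and3P[_ _ U2].
have [|r1 [y1 [y2 [r2 [Er y12 cy h3 h4]]]]] := cut_walk W2 w2 U2.
  by rewrite cx.2 leqnn.
exists x1, x2, y1, y2; split=> // z cz.
rewrite Er cat_rcons in w2; have wm := walk_take w2.
have Um : uniq (rcons r1 y1) by move: U2; rewrite Er cat_uniq => /andP[].
have colm z1 : z1 \in rcons r1 y1 -> col z1 = col x2.
  move=> z1r; apply/eqP; rewrite eqn_leq cx.2 h3 //=.
  by apply: h2; rewrite Er mem_cat z1r.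
have E1 : z \in rcons q1 x1 = false by apply/negP => /h1; rewrite cz ltnn.
have E2 : z \in y2 :: r2 = false by apply/negP => /h4; rewrite cz ltnn.
rewrite Eq Er mem_cat3 E1 E2 orbF /=.
rewrite (line_cells (g := @row _ _) _ _ wm Um colm) ?cz ?cx.2 ?eqxx //.
- by move=> *; apply: cell_inj.
- by move=> *; apply: adj_same_col.
Qed.

(** Each bounding cut has a single edge, so all simple walks across the column enter and leave it at
    the same cells. *)
Lemma gap_mem (c : nat) p p' u u' v v' z :
  walk e u v p -> uniq p -> walk e u' v' p' -> uniq p' ->
  col u <= c -> c.+1 < col v -> col u' <= c -> c.+1 < col v' ->
  room_right L < c.+1 -> (exists g, c.+1 < lcol L g) ->
  (forall g, ~~ (lcol L g <= c.+1 <= rcol L g)) ->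
  col z = c.+1 -> z \in p -> z \in p'.
Proof.
move=> wp Up wp' Up' uc cv uc' cv' rc [g cg] gap zc.
have [|W1 W2] := @one_wide_gap g c _ gap; first by rewrite rc.
have [x1 [x2 [y1 [y2 [x12 y12 [cx1 cx2] [cy1 cy2] ->]]]]] :=
  gap_part W1 W2 wp Up uc cv; last by [].
have [x1' [x2' [y1' [y2' [x12' y12' [cx1' cx2'] [cy1' cy2'] ->]]]]] :=
  gap_part W1 W2 wp' Up' uc' cv'; last by [].
have [_ ->] := one_wide_edge W1 x12 cx1 cx2 x12' cx1' cx2'.
by have [-> _] := one_wide_edge W2 y12 cy1 cy2 y12' cy1' cy2'.
Qed.

Lemma first_clause j : exists j0, forall j', lcol L (inr j0) <= lcol L (inr j').
Proof.
exists [arg min_(i < j) lcol L (inr i)].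
by case: arg_minnP => // i _ h j'; apply: h.
Qed.

Lemma lit_start_col j k :
  in_gadget L (inl (lit j k).1) (start M (Lit j k)).
Proof. exact: branch_in_gadget (V_literals (VS _) (erefl _)). Qed.

Lemma lit_target_in j k : in_gadget L (inr j) (target M (Lit j k)).
Proof. by case: (C_lit_target (CS j) k). Qed.

Lemma lit_target_row j k : row (target M (Lit j k)) = 1.
Proof. by case: (C_lit_target (CS j) k). Qed.

Lemma cla_target_in j : in_gadget L (inr j) (target M (Cla j)).
Proof. by case: (C_cla_target (CS j)). Qed.

Lemma cla_target_row j : row (target M (Cla j)) = 0.
Proof. by case: (C_cla_target (CS j)). Qed.

(** * Paths in the clause region, which starts at the leftmost clause gadget [j0] *)

Section FirstClause.
Context (j0 : 'I_(ncl phi)).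
Context (min_j0 : forall j, lcol L (inr j0) <= lcol L (inr j)).

Lemma clause_region j v : in_gadget L (inr j) v -> lcol L (inr j0) <= col v.
Proof. by case/andP => h _; apply: leq_trans (min_j0 j) h. Qed.

(** After its only crossing into the clause region the walk is simple and confined to the bottom
    row, so it fills that row up to [u]. *)
Lemma bottom_mem s u q : walk e s u (rcons q u) -> uniq (rcons q u) ->
  along_bottom L (rcons q u) -> col s < lcol L (inr j0) <= col u ->
  forall z, lcol L (inr j0) <= col z ->
    (z \in rcons q u) = (row z == 2) && (col z <= col u).
Proof.
move=> wq Uq bot /andP[sc cu] z cz.
have Ec : (lcol L (inr j0)).-1.+1 = lcol L (inr j0) by rewrite prednK // (leq_ltn_trans _ sc).
have [|q1 [x1 [y1 [q2 [Eq xy [cx cy] h1 h2]]]]] := cut_walk (one_wide_before Ec) wq Uq.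
  by rewrite -ltnS Ec sc.
have Nq1 : z \in rcons q1 x1 = false by apply/negP => /h1; rewrite leqNgt Ec cz.
have w2 := walk_drop (eq_ind _ (walk e s u) wq _ Eq).
have U2 : uniq (y1 :: q2) by move: Uq; rewrite Eq cat_uniq => /and3P[].
have row2 z1 : z1 \in y1 :: q2 -> row z1 = 2.
  move=> z1q; apply: bot; first by rewrite Eq mem_cat z1q orbT.
  by exists j0; rewrite -Ec h2.
have row1 z1 : z1 \in y1 :: q2 -> row z1 = row y1.
  by move=> /row2 ->; rewrite row2 ?mem_head.
rewrite Eq mem_cat Nq1 /= (line_cells (g := @col _ _) _ _ w2 U2 row1).
- by rewrite (row2 y1) ?mem_head // cy Ec; congr (_ && _); lia.
- by move=> *; apply: cell_inj.
- by move=> *; apply: adj_same_row.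
Qed.

Lemma lit_path_cells j k p z :
  shortest e (start M (Lit j k)) (target M (Lit j k)) p ->
  lcol L (inr j0) <= col z ->
  (z \in p) = (row z == 2) && (col z <= col (target M (Lit j k)))
              || (z == target M (Lit j k)).
Proof.
move=> sp cz; have [q [u [Ep bot ru cu]]] := C_lit_path (CS j) sp.
have Up := shortest_uniq sp; have wp := shortest_walk sp.
rewrite Ep rcons_uniq in Up; case/andP: Up => _ Uq.
rewrite Ep mem_rcons inE orbC; congr (_ || _).
have wq : walk e (start M (Lit j k)) u (rcons q u).
  by move: wp; rewrite Ep -cats1 cat_rcons => /walk_take.
rewrite (bottom_mem wq Uq bot) ?cu // (clause_region (lit_target_in j k)) andbT.
case/andP: (lit_start_col j k) => _; move=> h; apply: leq_ltn_trans h _.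
exact: (G_var_clause G).
Qed.

Lemma cla_path_cells j p :
  shortest e (start M (Cla j)) (target M (Cla j)) p ->
  exists k q r, [/\ p = q ++ target M (Lit j k) :: r,
    forall z, lcol L (inr j0) <= col z ->
      (z \in q) = (row z == 2) && (col z <= col (target M (Lit j k))) &
    forall z, z \in r -> row z = 0 /\ in_gadget L (inr j) z].
Proof.
move=> sp; have [k [q [u [u' [q' [Ep bot [ru cu] cu' r0]]]]]] := C_cla_path (CS j) sp.
have Up := shortest_uniq sp; have wp := shortest_walk sp.
exists k, (rcons q u), (u' :: q'); split=> //.
- move=> z cz; rewrite Ep cat_rcons in wp; rewrite Ep cat_uniq in Up.
  rewrite (bottom_mem (walk_take wp)) ?cu //; first by case/andP: Up.
  rewrite (clause_region (lit_target_in j k)) andbT.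
  exact: leq_ltn_trans (R_start R j) (G_room_first G _).
- move=> z zr; split; first by apply/eqP; move/allP: r0; apply.
  have w2 : walk e u' (target M (Cla j)) (u' :: q').
    by move: wp; rewrite Ep -cat_rcons => /walk_drop.
  have U2 : uniq (u' :: q') by move: Up; rewrite Ep -cat_rcons cat_uniq => /and3P[].
  have r0' z1 : z1 \in u' :: q' -> row z1 = row u'.
    by move=> z1q; rewrite !(eqP (allP r0 _ _)) ?mem_head.
  have := zr; rewrite (line_cells (g := @col _ _) _ _ w2 U2 r0').
  + have /andP[a1 a2] := lit_target_in j k; have /andP[a3 a4] := cla_target_in j.
    by rewrite /in_gadget cu'; clear -a1 a2 a3 a4; lia.
  + by move=> *; apply: cell_inj.
  + by move=> *; apply: adj_same_row.
Qed.

(** Within the clause region the path meets the middle row only where it crosses, so a literal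
    target of its clause on the path is that crossing. *)
Lemma cla_path_through j k p :
  shortest e (start M (Cla j)) (target M (Cla j)) p -> target M (Lit j k) \in p ->
  exists q r, [/\ p = q ++ target M (Lit j k) :: r,
    forall z, lcol L (inr j0) <= col z ->
      (z \in q) = (row z == 2) && (col z <= col (target M (Lit j k))) &
    forall z, z \in r -> row z = 0 /\ in_gadget L (inr j) z].
Proof.
move=> sp; have [k' [q [r [-> hq hr]]]] := cla_path_cells sp.
have ct := clause_region (lit_target_in j k); have rt := lit_target_row j k.
rewrite mem_cat hq // rt inE /= => /predU1P[->|/hr[]]; first by exists q, r.
by rewrite rt.
Qed.

(* Shortest walks with the same ends are equal as soon as the cells of one belong
   to the other, which is checked column by column. *)
Lemma lit_infix (d : 'I_(nvar phi) -> bool) j k p q :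
  shortest e (start M (Cla j)) (target M (Cla j)) p ->
  shortest e (start M (Lit j k)) (target M (Lit j k)) q ->
  (forall y, exists p1 p2, [/\ p = p1 ++ through L (d y) y ++ p2,
    forall z, z \in p1 -> col z < lcol L (inl y) &
    forall z, z \in p2 -> rcol L (inl y) < col z]) ->
  (forall y, rcol L (inl (lit j k).1) < lcol L (inl y) ->
    exists p1 p2, q = p1 ++ through L (d y) y ++ p2) ->
  d (lit j k).1 = (lit j k).2 -> target M (Lit j k) \in p ->
  exists p1 p2, p = p1 ++ q ++ p2.
Proof.
set x := (lit j k).1; set s := start M (Lit j k); set t := target M (Lit j k).
move=> sp sq dp dq dx tp; have Up := shortest_uniq sp; have wp := shortest_walk sp.
have sB : s \in branch L (d x) x by rewrite dx; apply: V_literals.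
have sT : s \in through L (d x) x by rewrite (branch_through _ sB) eqxx.
have ct : lcol L (inr j0) <= col t by apply: clause_region (lit_target_in j k).
have xc0 : rcol L (inl x) < lcol L (inr j0) by apply: G_var_clause.
have xt : rcol L (inl x) < col t by apply: leq_trans ct.
have [p1 [p2 [Ep p1x p2x]]] := dp x.
move: sT Ep dx; set T := through L (d x) x => sT Ep dx.
have tp2 : t \in p2.
  move: tp; rewrite Ep mem_cat3 => /or3P[/p1x|/through_in_gadget/andP[_]|//].
    by rewrite ltnNge ltnW // (leq_ltn_trans (G_gadgets G _)).
  by rewrite leqNgt xt.
case/splitPr: tp2 p2x Ep => r1 r2 p2x Ep.
have ET : T = take (index s T) T ++ drop (index s T) T by rewrite cat_take_drop.
have ED : drop (index s T) T = s :: drop (index s T).+1 T.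
  by rewrite (drop_nth s) ?index_mem // nth_index.
have Ep' : p = (p1 ++ take (index s T) T) ++ (drop (index s T) T ++ rcons r1 t) ++ r2.
  by rewrite Ep {1}ET -!catA cat_rcons.
(* [S] is the stretch of [p] from [s] to [t], a shortest walk with the same ends as [q]. *)
set S := drop (index s T) T ++ rcons r1 t in Ep'.
have ES : S = s :: behead S by rewrite /S ED.
have sS : shortest e s t S.
  rewrite Ep' in sp; apply: shortest_infix sp.
  have := wp; rewrite Ep' ES => /walk_infix.
  by have -> : last s (behead S) = t by rewrite /S ED /= last_cat last_rcons.
suff sub : {subset S <= q}.
  by exists (p1 ++ take (index s T) T), r2; rewrite {1}Ep' (shortest_sub_eq sS sq sub).
have [q2 Eq q2x] := gadget_suffix sq sB xt; rewrite -/T in Eq.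
move=> z; rewrite /S mem_cat => /orP[zT|zr1]; first by rewrite Eq mem_cat zT.
have xz : rcol L (inl x) < col z.
  by apply: p2x; rewrite -cat_rcons mem_cat zr1.
have zp : z \in p by rewrite Ep' /S !mem_cat zr1 !orbT.
(* To the right of the gadget of [x], a cell lies in the clause region, in a later variable gadget,
   or in a column between gadgets. *)
case: (leqP (lcol L (inr j0)) (col z)) => cz.
  move: zr1; rewrite mem_rcons inE (lit_path_cells sq cz) => /predU1P[->|zr1].
    by rewrite eqxx orbT.
  have [q' [r' [Ep2 h _]]] := cla_path_through sp tp.
  (* [t] occurs only once on [p], so the two splittings of [p] at [t] coincide. *)
  have [Eq' _] : q' = p1 ++ T ++ r1 /\ r' = r2.
    apply: (@uniq_split_inj _ t); first by rewrite -Ep2.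
    by rewrite -Ep2 Ep -!catA.
  by rewrite -h // Eq' mem_cat3 zr1 !orbT.
have sx : col s <= rcol L (inl x) by case/andP: (branch_in_gadget sB).
have roomx := G_room_first G (inl x); have lrx := G_gadgets G (inl x).
case: (pickP (fun y => in_gadget L (inl y) z)) => [y zy|no].
  have yx : rcol L (inl x) < lcol L (inl y).
    exact: gadget_right xz zy.
  have [a1 [a2 ->]] := dq _ yx; rewrite mem_cat3.
  have [b1 [b2 [Epy b1y b2y]]] := dp y.
  move: zp; rewrite Epy mem_cat3 => /or3P[/b1y|->|/b2y]; rewrite ?orbT //.
    by move: zy => /andP[]; rewrite leqNgt => /negPf->.
  by move: zy => /andP[_]; rewrite leqNgt => /negPf->.
have gap g : ~~ (lcol L g <= col z <= rcol L g).
  case: g => [y|j']; first by rewrite -[_ && _]/(in_gadget _ _ _) no.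
  by rewrite leqNgt (leq_trans cz) ?min_j0.
have Ec : (col z).-1.+1 = col z by rewrite prednK // (leq_ltn_trans _ xz).
have sx' : col s <= (col z).-1 by rewrite -ltnS Ec (leq_ltn_trans sx).
have cx' : col (start M (Cla j)) <= (col z).-1.
  rewrite -ltnS Ec; apply: leq_ltn_trans (R_start R j) _.
  by rewrite (ltn_trans roomx) // (leq_ltn_trans lrx).
have ctC : lcol L (inr j0) <= col (target M (Cla j)) by apply: clause_region (cla_target_in j).
apply: (gap_mem wp Up (shortest_walk sq) (shortest_uniq sq) cx' _ sx' _ _ _ _ _ zp); rewrite Ec //.
- exact: leq_trans ctC.
- exact: leq_trans ct.
- by rewrite (ltn_trans roomx) // (leq_ltn_trans lrx).
- by exists (inr j0).
Qed.

End FirstClause.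

End Layout.

(** * From a plan to an assignment *)

(** [destutter] recurses from the front, whereas a trajectory grows at its end. *)
Lemma destutter_rcons (T : eqType) (s : seq T) (x y : T) :
  destutter (rcons (rcons s x) y) =
  if x == y then destutter (rcons s x) else rcons (destutter (rcons s x)) y.
Proof.
elim: s => [|z s IH] /=; first by case: eqP => [->|].
case: s IH => [|z' s] /=.
  by move=> _; case: (z == x); case: eqP => [->|] //=; rewrite ?eqxx.
by move=> ->; case: (z == z'); case: (x == y).
Qed.

(** * Progress of an agent along its path *)

Section Track.
Context (V : finType) (e : rel V) (pi : nat -> V).
Let f (t : nat) : seq V := destutter (mkseq pi t.+1).

Lemma destutter_mkseqS t :
  f t.+1 = if pi t == pi t.+1 then f t else rcons (f t) (pi t.+1).
Proof. by rewrite /f (mkseqS pi t.+1) !(mkseqS pi t) destutter_rcons -mkseqS. Qed.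

Lemma destutter_mkseq_prefix t n : exists r, f (t + n) = f t ++ r.
Proof.
elim: n => [|n [r IH]]; first by exists [::]; rewrite addn0 cats0.
rewrite addnS destutter_mkseqS IH; case: eqP => _; first by exists r.
by exists (rcons r (pi (t + n).+1)); rewrite rcons_cat.
Qed.

Lemma destutter_mkseq_walk t :
  (forall i, pi i = pi i.+1 \/ e (pi i) (pi i.+1)) -> walk e (pi 0) (pi t) (f t).
Proof.
move=> step; elim: t => [|t IH]; first by rewrite /= !eqxx.
rewrite destutter_mkseqS; case: (eqVneq (pi t) (pi t.+1)) => [<- //|ne].
case: (step t) => [E|st]; first by rewrite E eqxx in ne.
case: (f t) IH => // x q /= /and3P[-> pq /eqP lq].
by rewrite rcons_path pq lq st last_rcons eqxx.
Qed.

(** [n t] is the position on the path at time [t]: the last index of the path walked so far, which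
    is a prefix of the whole path. *)
Lemma path_of_track p : path_of pi p -> exists n : nat -> nat,
  [/\ forall t, n t <= n t.+1 <= (n t).+1, n 0 = 0,
      forall t, n t < size p /\ nth (pi 0) p (n t) = pi t
    & exists t, n t = (size p).-1].
Proof.
case=> T [cst ->]; rewrite -/(f T).
have last_f t : last (pi 0) (f t) = pi t.
  elim: t => // t IH; rewrite destutter_mkseqS.
  by case: eqP => [<- //|_]; rewrite last_rcons.
have size_f t : 0 < size (f t).
  elim: t => // t IH; rewrite destutter_mkseqS; case: eqP => // _.
  by rewrite size_rcons.
have f_const n : f (T + n) = f T.
  elim: n => [|n IH]; first by rewrite addn0.
  by rewrite addnS destutter_mkseqS -addnS !cst ?leq_addr // eqxx.
exists (fun t => (size (f t)).-1); split=> //; last by exists T.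
- move=> t; rewrite destutter_mkseqS; case: eqP => _; rewrite ?leqnn ?leqnSn //.
  by rewrite size_rcons /= prednK // leqnn leq_pred.
- move=> t; have [r Er] : exists r, f T = f t ++ r.
    have [le|/ltnW le] := leqP t T; rewrite -(subnKC le).
      exact: destutter_mkseq_prefix.
    by exists [::]; rewrite f_const cats0.
  have lt : (size (f t)).-1 < size (f t) by rewrite prednK.
  rewrite Er size_cat nth_cat lt nth_last last_f; split=> //.
  by rewrite ltn_addr.
Qed.

Lemma path_of_walk v p : (exists T, forall t, T <= t -> pi t = v) ->
  (forall i, pi i = pi i.+1 \/ e (pi i) (pi i.+1)) ->
  path_of pi p -> walk e (pi 0) v p.
Proof.
case=> T' toT' step [T [cst ->]].
have -> : v = pi T by rewrite -(toT' (maxn T T')) ?leq_maxr // cst ?leq_maxl.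
exact: destutter_mkseq_walk.
Qed.

End Track.

(** * Agents on a common route, and plans of optimal cost *)

Section Plan.
Context (M : mapf) (pi : agents M -> nat -> vert M).

(* Both agents traverse the common part [p'], and the second is ahead, or
   level, when the first enters it, but behind, or level, when the first leaves
   it. *)
Lemma no_infix (r r' : agents M) p p' p1 p2 : collision_free pi -> r != r' ->
  path_of (pi r) p -> path_of (pi r') p' -> p = p1 ++ p' ++ p2 -> False.
Proof.
move=> free rr' /path_of_track[n [nS n0 nP [t nt]]] /path_of_track[m [mS m0 mP _]] Ep.
have ex : exists t, size p1 + m t <= n t.
  by exists t; rewrite nt Ep !size_cat; have [] := mP t; lia.
(* At [t0] the agent [r] first draws level with [r']. Before that it is strictly behind, and the gap
   [size p1 + m t - n t] shrinks by at most one per step, so at [t0] it is exactly zero: both agents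
   are on the same vertex. *)
have [t0 le0 min0] := ex_minnP ex.
have E0 : n t0 = size p1 + m t0.
  apply/eqP; rewrite eqn_leq le0 andbT.
  case: t0 {le0} min0 => [|t0] min0; first by rewrite n0.
  have lt : n t0 < size p1 + m t0.
    by rewrite ltnNge; apply/negP => /min0; rewrite ltnn.
  have /andP[_ h1] := nS t0; have /andP[h2 _] := mS t0.
  by apply: leq_trans h1 _; apply: leq_trans lt _; rewrite leq_add2l.
have [_ En] := nP t0; have [lm Em] := mP t0.
case: (free r r' rr') => /(_ t0) + _; apply.
rewrite -En -Em E0 Ep nth_cat ltnNge leq_addr /= addKn nth_cat lm.
exact: set_nth_default.
Qed.

Lemma optimal_paths : motion_plan pi -> distance_cost pi (dstar M) ->
  exists p : agents M -> seq (vert M), forall r,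
    path_of (pi r) (p r) /\ shortest (@edge M) (source r) (goal r) (p r).
Proof.
move=> plan [p [pP Ecost]]; exists p => r; split=> //.
have w r' : walk (@edge M) (source r') (goal r') (p r').
  by have [<- ? ?] := plan r'; apply: path_of_walk.
(* No path is shorter than the distance of its ends, so equality of the sums forces equality for
   every agent. *)
have := @leqif_sum _ xpredT _ _ _ (fun r' _ => leqif_eq (dist_le (w r'))).
rewrite -/(dstar M) -Ecost => -[_]; rewrite eqxx => /esym/forallP/(_ r) /eqP E.
by rewrite /shortest w E eqxx.
Qed.

End Plan.

Section Assignment.
Context (phi : cnf3) (M : grid phi) (L : layout M) (red : reduction L).
Local Notation e := (@adj (width M) (obstacles M)).

Lemma satisfiable_of_plan :
  (exists pi : agents (grid_mapf M) -> nat -> vert (grid_mapf M),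
    [/\ motion_plan pi, collision_free pi
      & distance_cost pi (dstar (grid_mapf M))]) -> satisfiable phi.
Proof.
case: (red) => G R VS CS [pi [plan free cost]].
have [p] := optimal_paths plan cost; rewrite /= => pP.
have pO r : path_of (pi r) (p r) by case: (pP r).
have pS r : shortest e (start M r) (target M r) (p r) by case: (pP r).
(* The variable is true when its blocker takes the top path, the one that carries the positive
   literals. *)
pose beta (y : 'I_(nvar phi)) := p (Blk y) == through L true y.
have betaP y : p (Blk y) = through L (beta y) y.
  rewrite /beta; case: eqP => // ne; have := pS (Blk y).
  rewrite (V_blocker_start (VS y)) (V_blocker_target (VS y)) => sp.
  by have [[] E] := V_only (VS y) (shortest_walk sp) (shortest_uniq sp).
(* On the branch of the blocker, the path of [r] would contain the whole path of the blocker,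
   against [no_infix]. *)
have pass r y b p1 p2 : r != Blk y -> p r = p1 ++ through L b y ++ p2 ->
    b = ~~ beta y.
  move=> ne Ep; have [E|] := eqVneq b (beta y); last by case: (b) (beta y) => [] [].
  case: (no_infix (p' := p (Blk y)) free ne (pO r) (pO (Blk y)) (p1 := p1) (p2 := p2)).
  by rewrite betaP -E.
exists beta => j.
have [j0 min_j0] := first_clause L j.
have [k [q [r [Ep _ _]]]] := cla_path_cells red min_j0 (pS (Cla j)).
(* The true literal is the one whose target the clause agent crosses. *)
exists k; set x := (lit j k).1.
have [//|ne] := eqVneq (beta x) (lit j k).2; exfalso.
(* The agent of a false literal starts on the branch that all agents crossing the gadget behind the
   blocker have to take. *)
have dx : ~~ beta x = (lit j k).2 by case: (beta x) (lit j k).2 ne => [] [].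
have tp : target M (Lit j k) \in p (Cla j) by rewrite Ep mem_cat mem_head orbT.
have to_right v y j' : in_gadget L (inr j') v -> rcol L (inl y) < col v.
  by case/andP=> + _; apply: leq_trans; apply: G_var_clause G _ _.
have [|y yx|p1 [p2 Ej]] :=
  lit_infix red min_j0 (pS (Cla j)) (pS (Lit j k)) (d := fun y => ~~ beta y) _ _ dx tp.
- move=> y; have sp := pS (Cla j).
  have [|b [p1 [p2 [Ey h1 h2]]]] :=
    gadget_split red (shortest_walk sp) (shortest_uniq sp) _
      (to_right _ y _ (cla_target_in red j)).
    exact: leq_ltn_trans (R_start R j) (G_room_first G _).
  by exists p1, p2; rewrite -(pass (Cla j) y b p1 p2).
- have sp := pS (Lit j k).
  have [|b [p1 [p2 [Ey _ _]]]] :=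
    gadget_split red (shortest_walk sp) (shortest_uniq sp) _
      (to_right _ y _ (lit_target_in red j k)).
    by case/andP: (lit_start_col red j k) => _ h; apply: leq_ltn_trans yx.
  by exists p1, p2; rewrite -(pass (Lit j k) y b p1 p2).
- by apply: (no_infix free _ (pO (Cla j)) (pO (Lit j k)) Ej).
Qed.

End Assignment.

(** * From an assignment to a plan *)

Section Schedule.
Context (M : mapf).
Local Notation e := (@edge M).
Local Notation config := {ffun agents M -> vert M}.
Implicit Types (f g h : config) (r : agents M).

(* Every move brings its agent closer to its goal, so that the cost of a
   schedule is [dstar]. *)
Definition step f g : bool :=
  [exists r, [&& e (f r) (g r), dist e (f r) (goal r) == (dist e (g r) (goal r)).+1
    & [forall r', (r' != r) ==> (g r' == f r') && (f r' != g r)]]].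

Lemma stepP f g : reflect (exists r, [/\ e (f r) (g r),
    dist e (f r) (goal r) = (dist e (g r) (goal r)).+1,
    forall r', r' != r -> g r' = f r' & forall r', r' != r -> f r' != g r])
  (step f g).
Proof.
apply: (iffP existsP) => [[r /and3P[E /eqP D /forallP h]]|[r [E D h1 h2]]]; exists r.
  by split=> // r' ne; have /implyP/(_ ne)/andP[/eqP] := h r'.
rewrite E D eqxx /=; apply/forallP => r'; apply/implyP => ne.
by rewrite h1 // eqxx h2.
Qed.

Lemma step_inj f g : step f g -> injective f -> injective g.
Proof.
case/stepP => r [_ _ h1 h2] injf r1 r2.
have [->|ne1] := eqVneq r1 r; have [->|ne2] := eqVneq r2 r => //.
- by rewrite (h1 _ ne2) => E; have := h2 _ ne2; rewrite E eqxx.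
- by rewrite (h1 _ ne1) => E; have := h2 _ ne1; rewrite E eqxx.
- by rewrite !h1 // => /injf.
Qed.

Lemma step_swap f g r1 r2 : step f g -> injective f -> injective g -> r1 != r2 ->
  (f r1, g r1) <> (g r2, f r2).
Proof.
case/stepP => r [_ _ h1 _] injf injg ne [E1 E2].
have [E|ne1] := eqVneq r1 r; last by move: E2; rewrite h1 // => /injf; apply/eqP.
have [E'|ne2] := eqVneq r2 r; first by rewrite E E' eqxx in ne.
by move: E1; rewrite h1 // => /injf; apply/eqP.
Qed.

Lemma plan_of_schedule : injective (@source M) ->
  connect step [ffun r => source r] [ffun r => goal r] ->
  exists pi : agents M -> nat -> vert M,
    [/\ motion_plan pi, collision_free pi & distance_cost pi (dstar M)].
Proof.
move=> inj_s; set f0 := [ffun r => source r]; set f1 := [ffun r => goal r].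
(* Past the last move, the default value of [nth] keeps all agents at their goals. *)
case/connectP => s ps Es; pose c t := nth f1 (f0 :: s) t.
have cE t : size s <= t -> c t = f1.
  rewrite leq_eqVlt => /predU1P[<-|lt]; last exact: nth_default.
  by rewrite Es /c -[size s]/(size (f0 :: s)).-1 nth_last.
have cS t : step (c t) (c t.+1) \/ c t = c t.+1.
  have [le|lt] := leqP (size s) t; last by left; apply: (pathP _ ps).
  by right; rewrite !cE // leqW.
have cI t : injective (c t).
  elim: t => [|t IH]; first by move=> r1 r2; rewrite /c /= !ffunE => /inj_s.
  by case: (cS t) => [/step_inj|<-]; first exact.
exists (fun r t => c t r); split.
- move=> r; split.
  + by rewrite /c /= ffunE.
  + by exists (size s) => t le; rewrite cE // ffunE.
  + move=> t; case: (cS t) => [/stepP[r' [E _ h _]]|->]; last by left.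
    have [->|ne] := eqVneq r r'; first by right.
    by left; rewrite h.
- move=> r r' ne; split=> t.
    by move/cI => E; rewrite E eqxx in ne.
  case: (cS t) => [st|->]; first exact: (step_swap st).
  by case => /cI E; rewrite E eqxx in ne.
- pose p r := destutter (mkseq (fun t => c t r) (size s).+1).
  exists p; split=> [r|].
    by exists (size s); split=> // t le; rewrite !cE.
  apply: eq_bigr => r _.
  (* Invariant: the path walked so far and the remaining distance add up to the initial distance;
     the extra one appears because [size] counts vertices. *)
  have E t : size (destutter (mkseq (fun t => c t r) t.+1)) + dist e (c t r) (goal r)
      = (dist e (source r) (goal r)).+1.
    elim: t => [|t IH]; first by rewrite /c /= ffunE add1n.
    rewrite destutter_mkseqS; case: eqP => [<- //|ne].
    rewrite size_rcons addSnnS -IH; congr (_ + _); symmetry.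
    case: (cS t) => [/stepP[r' [_ D h _]]|E]; last by rewrite E in ne.
    have [-> //|ne'] := eqVneq r r'; by rewrite h in ne.
  have := E (size s); rewrite cE // ffunE.
  have /eqP -> : dist e (goal r) (goal r) == 0.
    by rewrite -leqn0 (@dist_le _ e _ _ [:: goal r]) //= !eqxx.
  by rewrite addn0 -/(p r) => ->.
Qed.

(** The rest [q] allows an agent to stop on the way to its goal, as a blocker does when it
    withdraws; every move along [p] still brings it closer. *)
Lemma run f r p q v : shortest e (f r) (goal r) (p ++ q) -> walk e (f r) v p ->
  (forall r', r' != r -> f r' \notin p) ->
  connect step f [ffun r' => if r' == r then v else f r'].
Proof.
elim: p f => [|u [|u' p] IH] f sp; rewrite /walk; first by []; case/and3P=> /eqP Eu.
  move=> _ /eqP Ev _; suff -> : [ffun r' => if r' == r then v else f r'] = f by [].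
  by apply/ffunP => r'; rewrite ffunE; case: eqP => // ->; rewrite -Ev.
case/andP=> fu' pu' /eqP lp free;
pose f' : config := [ffun r' => if r' == r then u' else f r'].
have f'r : f' r = u' by rewrite ffunE eqxx.
have sp' : shortest e u' (goal r) ((u' :: p) ++ q).
  by move: sp; rewrite -cat1s -catA => /shortest_drop.
apply: (@connect_trans _ _ f').
  apply: connect1; apply/stepP; exists r; rewrite f'r; split=> //.
  - have /= := shortest_size sp; have /= := shortest_size sp'.
    by rewrite !size_cat /= => -[<-] [<-].
  - by move=> r' ne; rewrite ffunE (negPf ne).
  - by move=> r' /free; rewrite !inE !negb_or => /and3P[].
have -> : [ffun r' => if r' == r then v else f r'] =
          [ffun r' => if r' == r then v else f' r'] :> config.
  by apply/ffunP => r'; rewrite !ffunE; case: eqP.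
apply: IH; rewrite ?f'r //; first by apply/and3P; split=> //; apply/eqP.
move=> r' ne; rewrite ffunE (negPf ne).
by have := free _ ne; rewrite inE negb_or => /andP[].
Qed.

(** The agents of [l] run in turn: when [r] starts, those of [l1] are already at their places in [g]
    and all others are still where [f] has them. *)
Lemma run_seq (l : seq (agents M)) f g : uniq l -> (forall r, r \notin l -> f r = g r) ->
  (forall l1 r l2, l = l1 ++ r :: l2 -> exists p q,
    [/\ shortest e (f r) (goal r) (p ++ q), walk e (f r) (g r) p &
      forall r', r' != r -> (if r' \in l1 then g r' else f r') \notin p]) ->
  connect step f g.
Proof.
move=> Ul fg runs.
have -> : g = [ffun r => if r \in l then g r else f r].
  by apply/ffunP => r; rewrite ffunE; case: ifPn => // /fg.
elim/last_ind: l Ul runs {fg} => [|l r IH].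
  by move=> _ _; suff -> : [ffun r => if r \in [::] then g r else f r] = f by [];
     apply/ffunP => r; rewrite ffunE.
rewrite rcons_uniq => /andP[rl Ul] runs.
have {IH} := IH Ul; set f' := [ffun _ => _] => IH.
apply: (@connect_trans _ _ f').
  by apply: IH => l1 r1 l2 E; apply: (runs l1 r1 (rcons l2 r)); rewrite E rcons_cat.
have [|p [q [sp wp free]]] := runs l r [::]; first by rewrite cats1.
have f'r : f' r = f r by rewrite ffunE (negPf rl).
have -> : [ffun r' => if r' \in rcons l r then g r' else f r'] =
          [ffun r' => if r' == r then g r else f' r'] :> config.
  apply/ffunP => r'; rewrite !ffunE mem_rcons inE.
  by case: (eqVneq r' r) => [->|].
apply: (run (p := p) (q := q)); rewrite ?f'r // => r' ne.
by rewrite ffunE; exact: free.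
Qed.

End Schedule.

(** * Routes of the agents and phases of the schedule for an assignment [a] *)

Section Construction.
Context (phi : cnf3) (M : grid phi) (L : layout M) (red : reduction L).
Local Notation V := (cell (obstacles M)).
Local Notation e := (@adj (width M) (obstacles M)).
Context (a : 'I_(nvar phi) -> bool).
(** The waiting cells of the blockers, on the branches of the true literals; the branches [~~ a y]
    stay open to traffic. *)
Context (mid : 'I_(nvar phi) -> V).
Context (mid_branch : forall y, mid y \in branch L (a y) y).
Context (mid_first : forall y j k, lit j k = (y, a y) ->
  index (mid y) (through L (a y) y) < index (start M (Lit j k)) (through L (a y) y)).
Implicit Types (u v z : V) (p q : seq V) (x y : 'I_(nvar phi)) (b : bool)
  (g h : gadget phi) (j : 'I_(ncl phi)) (k : 'I_3).

Let G : grid_spec L. Proof. by case: red. Qed.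
Let R : room_spec L. Proof. by case: red. Qed.
Let VS x : var_spec L x. Proof. by case: red. Qed.
Let CS j : clause_spec L j. Proof. by case: red. Qed.

Lemma var_gadget_inj x y z : in_gadget L (inl x) z -> in_gadget L (inl y) z -> x = y.
Proof. by move=> h1 h2; have [] := gadgets_apart red h1 h2. Qed.

Lemma clause_gadget_inj i j z : in_gadget L (inr i) z -> in_gadget L (inr j) z -> i = j.
Proof. by move=> h1 h2; have [] := gadgets_apart red h1 h2. Qed.

Lemma var_not_clause x j z : in_gadget L (inl x) z -> in_gadget L (inr j) z -> False.
Proof. by move=> h1 h2; have := gadgets_apart red h1 h2. Qed.

Lemma gadget_not_room g z : in_gadget L g z -> room_right L < col z.
Proof. by case/andP => + _; apply: leq_trans; exact: G_room_first. Qed.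

Lemma cla_start_room j : col (start M (Cla j)) <= room_right L.
Proof. exact: R_start. Qed.

Lemma lit_start_branch j k : start M (Lit j k) \in branch L (lit j k).2 (lit j k).1.
Proof. exact: V_literals. Qed.

Lemma mid_in_gadget y : in_gadget L (inl y) (mid y).
Proof. exact (branch_in_gadget red (mid_branch y)). Qed.

Lemma mid_not_through y : mid y \notin through L (~~ a y) y.
Proof. by rewrite (branch_through red _ (mid_branch y)); case: (a y). Qed.

Lemma lit_start_through b y j k : in_gadget L (inl y) (start M (Lit j k)) ->
  start M (Lit j k) \in through L b y -> (lit j k).1 = y /\ (lit j k).2 = b.
Proof.
move=> gy; have E := var_gadget_inj (lit_start_col red j k) gy.
by rewrite -{1}E (branch_through red _ (lit_start_branch j k)) => /eqP.
Qed.

Section Clauses.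
Context (j0 : 'I_(ncl phi)).
Context (min_j0 : forall j, lcol L (inr j0) <= lcol L (inr j)).

Lemma var_left y z : in_gadget L (inl y) z -> col z < lcol L (inr j0).
Proof. by case/andP=> _ h; apply: leq_ltn_trans h _; apply: G_var_clause G _ _. Qed.

Lemma lit_route j k : exists2 p,
  shortest e (start M (Lit j k)) (target M (Lit j k)) p &
  forall z, z \in p ->
    [\/ z \in drop (index (start M (Lit j k)) (through L (lit j k).2 (lit j k).1))
           (through L (lit j k).2 (lit j k).1),
       exists y, in_gadget L (inl y) z /\ z \in through L (~~ a y) y,
       lcol L (inr j0) <= col z /\ (row z = 2 \/ z = target M (Lit j k))
     | room_right L < col z < lcol L (inr j0) /\ forall y, ~~ in_gadget L (inl y) z].
Proof.
set s := start M _; set t := target M _; set x := (lit j k).1; set b := (lit j k).2.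
have [p0 sp0] := dist_walk (G_connected G s t).
have [p [sp h1 _]] := reroute red (fun y => ~~ a y) sp0.
exists p => // z zp.
have sg : in_gadget L (inl x) s by exact: lit_start_col.
have ct : lcol L (inr j0) <= col t := clause_region min_j0 (lit_target_in red j k).
have yt y : rcol L (inl y) < col t by apply: leq_trans (G_var_clause G _ _) ct.
have [p2 Ep p2x] := gadget_suffix red sp (lit_start_branch j k) (yt x).
have := zp; rewrite {1}Ep mem_cat => /orP[?|/p2x xz]; first by constructor 1.
have [cz|cz] := leqP (lcol L (inr j0)) (col z).
  constructor 3; split=> //; move: zp; rewrite (lit_path_cells red min_j0 sp cz).
  by case/orP => [/andP[/eqP ? _]|/eqP]; [left | right].
case: (pickP (fun y => in_gadget L (inl y) z)) => [y zy|no].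
  constructor 2; exists y; split=> //; apply: h1 => //.
  have := gadget_right red xz zy; apply: leq_ltn_trans.
  by case/andP: sg.
constructor 4; split=> [|y]; last by rewrite no.
rewrite andbT (ltn_trans (G_room_first G (inl x))) //.
exact: leq_ltn_trans (G_gadgets G _) xz.
Qed.

(** What can obstruct this route is only a literal agent still at its start: one of a false literal,
    met on an open branch, or one of the same literal, met on the own branch. *)
Lemma lit_run j k : exists p,
  [/\ shortest e (start M (Lit j k)) (target M (Lit j k)) p,
      (forall j', start M (Cla j') \notin p) /\ (forall j', target M (Cla j') \notin p),
      forall y, mid y \notin p,
      forall j' k', Lit j' k' != Lit j k -> target M (Lit j' k') \notin p &
      forall j' k', start M (Lit j' k') \in p -> (lit j' k').2 = ~~ a (lit j' k').1 \/
        (lit j' k').1 = (lit j k).1 /\ (lit j' k').2 = (lit j k).2].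
Proof.
have [p sp cells] := lit_route j k; exists p.
set T := through L (lit j k).2 (lit j k).1 in cells.
have dropT z : z \in drop (index (start M (Lit j k)) T) T -> in_gadget L (inl (lit j k).1) z.
  by move=> /mem_drop; apply: through_in_gadget red _ _ _.
have UT : uniq T by exact: shortest_uniq (through_shortest red _ _).
have inclause z i : in_gadget L (inr i) z -> z \in p -> row z = 2 \/ z = target M (Lit j k).
  move=> zi /cells[/dropT zx|[y [zy _]]|[_ //]|[/andP[_]]].
  - by case: (var_not_clause zx zi).
  - by case: (var_not_clause zy zi).
  - by rewrite ltnNge (clause_region min_j0 zi).
split=> //.
- split=> j'; apply/negP.
    have rs := cla_start_room j'; move/cells => [/dropT|[y [+ _]]|[c0 _]|[/andP[+ _] _]].
    + by move/gadget_not_room; rewrite ltnNge rs.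
    + by move/gadget_not_room; rewrite ltnNge rs.
    + by move: (leq_trans c0 rs); rewrite leqNgt (G_room_first G).
    + by rewrite ltnNge rs.
  move/(inclause _ _ (cla_target_in red j')); have := cla_target_row red j'.
  by move=> r0 [|E]; [rewrite r0 | move: r0; rewrite E (lit_target_row red)].
- move=> y; apply/negP => mp; have my := mid_in_gadget y.
  case: (cells _ mp) => [mT|[y' [my' my't]]|[c0 _]|[_ /(_ y)]].
  (* If the waiting cell is on the own branch, it precedes every literal start there, so the
     remaining way misses it. *)
  + have E := var_gadget_inj (dropT _ mT) my.
    have := index_drop_mem UT mT; rewrite leqNgt => /negP; apply.
    have /eqP Eb : a y == (lit j k).2.
      by have := mem_drop mT; rewrite /T E (branch_through red _ (mid_branch y)).
    rewrite /T -Eb E; apply: mid_first; rewrite Eb -E.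
    exact: surjective_pairing.
  + by move: my't; rewrite -(var_gadget_inj my my') (negPf (mid_not_through y)).
  + by have := var_left my; rewrite ltnNge c0.
  + by rewrite my.
- move=> j' k' ne; apply/negP => /(inclause _ _ (lit_target_in red j' k')) [|E].
    by rewrite (lit_target_row red).
  by have E' := G_target_inj G E; rewrite E' eqxx in ne.
- move=> j' k'; set s' := start M _ => s'p.
  have s'g : in_gadget L (inl (lit j' k').1) s' by exact: lit_start_col.
  case: (cells _ s'p) => [sT|[y [sy st]]|[c0 _]|[_ /(_ (lit j' k').1)]].
  + by right; apply: lit_start_through (dropT _ sT) (mem_drop sT).
  + by left; have [-> ->] := lit_start_through sy st.
  + by have := var_left s'g; rewrite ltnNge c0.
  + by rewrite s'g.
Qed.

(** The route is spliced together: up to the door it is the walk given by the room, afterwards a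
    shortest path through the chosen literal target, and finally the variable gadgets are rerouted
    to the open branches. *)
Lemma cla_run (o : seq 'I_(ncl phi)) j k :
  (exists2 p, shortest e (start M (Cla j)) (door L) p &
    forall j', index j o < index j' o -> start M (Cla j') \notin p) ->
  exists p,
  [/\ shortest e (start M (Cla j)) (target M (Cla j)) p,
      forall j', index j o < index j' o -> start M (Cla j') \notin p,
      (forall j', j' != j -> target M (Cla j') \notin p) /\ (forall y, mid y \notin p),
      forall j' k', Lit j' k' != Lit j k -> target M (Lit j' k') \notin p &
      forall j' k', start M (Lit j' k') \in p -> (lit j' k').2 = ~~ a (lit j' k').1].
Proof.
case=> pR spR freeR; set s := start M (Cla j); set t := target M (Lit j k).
have [p0 sp0 tp0] := C_cla_any (CS j) k.
have wide := one_wide_room red (inr j).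
have sR : col s <= room_right L := cla_start_room j.
have Ttarget := gadget_not_room (cla_target_in red j).
have [|q1 [x1 [y1 [q2 [Ep0 xy [cx cy] h1 h2]]]]] :=
  cut_walk wide (shortest_walk sp0) (shortest_uniq sp0); first by rewrite sR.
have Ex : x1 = door L by exact (R_leave R xy cx cy).
subst x1.
have sp1 : shortest e s (target M (Cla j)) (pR ++ y1 :: q2).
  rewrite Ep0 -[rcons _ _ ++ _]cat0s in sp0.
  apply: (@shortest_replace _ _ _ _ s (door L) [::] _ _ _ _ spR sp0).
  by have := shortest_walk sp0; rewrite cat0s cat_rcons => /walk_take.
have [p [sp through_p same]] := reroute red (fun y => ~~ a y) sp1.
have noVar z : col z <= room_right L \/ lcol L (inr j0) <= col z ->
    forall y, ~~ in_gadget L (inl y) z.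
  move=> [h|h] y; apply/negP => zy.
    by have := gadget_not_room zy; rewrite ltnNge h.
  by have := var_left zy; rewrite ltnNge h.
have ct := clause_region min_j0 (lit_target_in red j k).
have tp : t \in p.
  rewrite same; last by apply: noVar; right.
  move: tp0; rewrite Ep0 !mem_cat => /orP[/h1|->]; last by rewrite orbT.
  by rewrite leqNgt (gadget_not_room (lit_target_in red j k)).
have inVar y z : in_gadget L (inl y) z -> z \in p -> z \in through L (~~ a y) y.
  move=> zy zp; apply: through_p => //.
    exact: leq_ltn_trans sR (G_room_first G _).
  apply: leq_trans (G_var_clause G _ j0) _.
  exact (clause_region min_j0 (cla_target_in red j)).
have [q [r [Ep hq hr]]] := cla_path_through red min_j0 sp tp.
exists p; split=> //.
- move=> j' /freeR; apply: contra; have rs := cla_start_room j'.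
  rewrite same; last by apply: noVar; left.
  by rewrite mem_cat => /orP[//|/h2]; rewrite ltnNge rs.
- split=> [j' ne|y]; last first.
    by apply/negP => /(inVar _ _ (mid_in_gadget y)); apply/negP; exact: mid_not_through.
  have cz := clause_region min_j0 (cla_target_in red j').
  rewrite Ep mem_cat hq // (cla_target_row red) //= inE negb_or; apply/andP; split.
    apply/eqP => E; have := cla_target_row red j'; by rewrite E (lit_target_row red).
  apply/negP => /hr[_ jj']; case/eqP: ne.
  exact: clause_gadget_inj (cla_target_in red j') jj'.
- move=> j' k' ne; have cz := clause_region min_j0 (lit_target_in red j' k').
  rewrite Ep mem_cat hq // (lit_target_row red) //= inE negb_or; apply/andP; split.
    by apply: contra ne => /eqP/(G_target_inj G)->.
  by apply/negP => /hr[]; rewrite (lit_target_row red).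
- move=> j' k' s'p; have s'g := lit_start_col red j' k'.
  by have [] := lit_start_through s'g (inVar _ _ s'g s'p).
Qed.

(** [w] is the cell where the one-wide passage reaches the leftmost clause gadget. Every path into
    the clause region passes it, so a start further along the path of an agent is strictly closer to
    [w]. *)
Lemma key_exists : exists w : V, forall s v p s', shortest e s v p ->
  col s < lcol L (inr j0) <= col v -> s' \in p -> col s' < lcol L (inr j0) ->
  s' != s -> dist e s' w < dist e s w.
Proof.
have Ec : (lcol L (inr j0)).-1.+1 = lcol L (inr j0).
  by rewrite prednK // (leq_ltn_trans _ (G_room_first G _)).
have wide := one_wide_before red Ec.
have /eqP/cards1P[[w' w] Ew] := wide; exists w => s v p s' sp /andP[sc cv] s'p s'c ne.
have [|q1 [x [y [q2 [Ep xy [cx cy] h1 h2]]]]] :=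
  cut_walk wide (shortest_walk sp) (shortest_uniq sp).
  by rewrite -ltnS Ec sc.
have Ey : y = w.
  have : (x, y) \in [set (w', w)] by rewrite -Ew inE /= xy cx cy !eqxx.
  by rewrite inE => /eqP[].
have {}s'p : s' \in rcons q1 x.
  by move: s'p; rewrite Ep mem_cat => /orP[//|/h2]; rewrite Ec leqNgt s'c.
rewrite Ep Ey in sp; have := shortest_take sp.
case/splitPr: s'p => r1 r2 sw.
have sw' : shortest e s w (r1 ++ s' :: rcons r2 w) by rewrite -rcons_cons -rcons_cat.
have r1_gt0 : 0 < size r1.
  case: r1 sw' {sw} => // sw'.
  by have := shortest_walk sw' => /and3P[]; rewrite (negPf ne).
have : size (s' :: rcons r2 w) < size (r1 ++ s' :: rcons r2 w).
  by rewrite size_cat -[X in X < _]add0n ltn_add2r.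
by rewrite (shortest_size (shortest_drop sw')) (shortest_size sw') ltnS.
Qed.

Local Notation config := {ffun agents (grid_mapf M) -> vert (grid_mapf M)}.

Definition conf (B : 'I_(nvar phi) -> V) (S : 'I_(ncl phi) -> 'I_3 -> bool)
    (C : bool) : config :=
  [ffun r : agent phi => match r with
   | Lit j k => if S j k then target M (Lit j k) else start M (Lit j k)
   | Cla j => if C then target M (Cla j) else start M (Cla j)
   | Blk y => B y
   end].

(** The closure condition ensures that a literal agent standing in the way of a moving one moves in
    the same phase. It holds for the false literals alone, and for the true ones once the false ones
    have arrived. *)
Lemma lit_phase (S S' : 'I_(ncl phi) -> 'I_3 -> bool) (C : bool) :
  (forall j k, S j k -> S' j k) ->
  (forall j k j' k', S' j k -> ~~ S j k ->
    (lit j' k').2 = ~~ a (lit j' k').1 \/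
      (lit j' k').1 = (lit j k).1 /\ (lit j' k').2 = (lit j k).2 -> S' j' k') ->
  connect (@step (grid_mapf M)) (conf mid S C) (conf mid S' C).
Proof.
move=> SS' closed; have [w key] := key_exists.
pose moving (r : agent phi) := if r is Lit j k then S' j k && ~~ S j k else false.
pose leK := relpre (fun r : agent phi => dist e (start M r) w) leq.
(* Sorting by the distance to [w] sends the front-most agents first. *)
pose l := sort leK (filter moving (enum (agents (grid_mapf M)))).
have leK_tr : transitive leK by move=> ? ? ?; apply: leq_trans.
have l_sorted : sorted leK l by apply: sort_sorted => ? ?; apply: leq_total.
have mem_l r : r \in l = moving r.
  by rewrite mem_sort mem_filter mem_enum inE andbT.
have Ul : uniq l by rewrite sort_uniq filter_uniq // enum_uniq.
apply: (@run_seq (grid_mapf M) l _ _ Ul) => [r|l1 r l2 El].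
  rewrite mem_l !ffunE; case: r => //= j k; rewrite negb_and negbK.
  case/orP => [S'N|Sjk]; last by rewrite Sjk SS'.
  have SN : ~~ S j k by apply: contra S'N; apply: SS'.
  by rewrite (negPf S'N) (negPf SN).
have : r \in l by rewrite El mem_cat mem_head orbT.
rewrite mem_l; case: r El => // j k El /= /andP[S'jk Sjk].
have [p [sp [freeS freeT] freeM freeL freeB]] := lit_run j k.
exists p, [::]; split.
- by rewrite cats0 !ffunE (negPf Sjk).
- by rewrite !ffunE (negPf Sjk) S'jk; apply: shortest_walk sp.
case=> [j' k'|j'|y] ne; rewrite ?ffunE; last by rewrite if_same.
  have [in1|Nin1] := ifPn.
    have : Lit j' k' \in l by rewrite El mem_cat in1.
    by rewrite mem_l => /andP[-> _]; apply: freeL.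
  case: ifPn => [_|Sj'k']; first exact: freeL.
  (* An agent in the way would have to come later in the sorted list, although it is strictly closer
     to [w]. *)
  apply/negP => sp'; have S'j'k' := closed _ _ _ _ S'jk Sjk (freeB _ _ sp').
  have in2 : Lit j' k' \in l2.
    have : Lit j' k' \in l by rewrite mem_l /= S'j'k' Sj'k'.
    by rewrite El mem_cat (negPf Nin1) inE (negPf ne).
  have : leK (Lit j k) (Lit j' k').
    move: l_sorted; rewrite El => /cat_sorted2[_].
    by rewrite /= (path_sortedE leK_tr) => /andP[/allP/(_ _ in2)].
  apply/negP; rewrite -ltnNge /=; apply: (key _ _ _ _ sp) => //.
  - rewrite (var_left (lit_start_col red j k)).
    exact (clause_region min_j0 (lit_target_in red j k)).
  - exact: var_left (lit_start_col red j' k').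
  - by apply: contra ne => /eqP/(G_start_inj G)->.
by rewrite if_same; case: (C).
Qed.

Lemma cla_phase (S : 'I_(ncl phi) -> 'I_3 -> bool) :
  (forall j k, S j k = ((lit j k).2 == ~~ a (lit j k).1)) ->
  (forall j, exists k, a (lit j k).1 = (lit j k).2) ->
  connect (@step (grid_mapf M)) (conf mid S false) (conf mid S true).
Proof.
move=> SE sat; have [o perm_o leave] := R_order R.
pose l : seq (agent phi) := map (@Cla phi) o.
have Cla_inj : injective (@Cla phi) by move=> ? ? [].
have Uo : uniq o by rewrite (perm_uniq perm_o) enum_uniq.
have mem_o j : j \in o by rewrite (perm_mem perm_o) mem_enum.
have Ul : uniq (l : seq (agents (grid_mapf M))) by rewrite map_inj_uniq.
apply: (@run_seq (grid_mapf M) l _ _ Ul) => [r|l1 r l2 El].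
  by rewrite !ffunE; case: r => // j; rewrite mem_map ?mem_o.
have : r \in l by rewrite El mem_cat mem_head orbT.
case/mapP => j _ Er; rewrite Er in El *.
(* The agent of a true literal has not moved yet, so its target is free to be crossed. *)
have [k satk] := sat j.
have Sjk : S j k = false by rewrite SE -satk; case: (a _).
have [p [sp freeS [freeT freeM] freeL freeB]] := cla_run k (leave j).
exists p, [::]; split.
- by rewrite cats0 !ffunE.
- by rewrite !ffunE; apply: shortest_walk sp.
case=> [j' k'|j'|y] ne; rewrite ?ffunE; last by rewrite if_same.
  rewrite if_same; case: ifPn => [S'|].
    by apply: freeL; apply: contraTneq S' => -[-> ->]; rewrite Sjk.
  by rewrite SE; apply: contra => /freeB ->.
have [in1|Nin1] := ifPn; first by apply: freeT; apply: contra ne => /eqP ->.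
(* [j'] is not in [l1] and differs from [j], so it comes after [j] in the order [o] of leaving the
   room. *)
apply: freeS; rewrite -!(index_map Cla_inj) -/l El !index_cat (negPf Nin1).
have -> : Cla j \in l1 = false.
  by move: Ul; rewrite El cat_uniq => /and3P[_ /hasPn/(_ _ (mem_head _ _))/negPf].
by rewrite /= eqxx eq_sym (negPf ne) addn0 -addSnnS leq_addr.
Qed.

Lemma traffic_phases :
  (forall j, exists k, a (lit j k).1 = (lit j k).2) ->
  connect (@step (grid_mapf M)) (conf mid (fun _ _ => false) false)
    (conf mid (fun _ _ => true) true).
Proof.
move=> sat; pose S j k := (lit j k).2 == ~~ a (lit j k).1.
apply: (@connect_trans _ _ (conf mid S false)).
  apply: lit_phase => // j k j' k' Sjk _; rewrite /S => -[->|[-> ->]] //.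
apply: (@connect_trans _ _ (conf mid S true)); first exact: cla_phase.
exact: lit_phase.
Qed.

End Clauses.

(** Each blocker follows its branch only up to the waiting cell, before which no literal agent
    starts. *)
Lemma blk_out_phase :
  connect (@step (grid_mapf M)) (conf (fun y => start M (Blk y)) (fun _ _ => false) false)
    (conf mid (fun _ _ => false) false).
Proof.
pose l : seq (agent phi) := map (@Blk phi) (enum 'I_(nvar phi)).
have Blk_inj : injective (@Blk phi) by move=> ? ? [].
have Ul : uniq (l : seq (agents (grid_mapf M))) by rewrite map_inj_uniq // enum_uniq.
apply: (@run_seq (grid_mapf M) l _ _ Ul) => [r|l1 r l2 El].
  by rewrite !ffunE; case: r => // y; rewrite mem_map // mem_enum.
have : r \in l by rewrite El mem_cat mem_head orbT.
case/mapP => y _ Er; rewrite Er in El *.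
have mT : mid y \in through L (a y) y by rewrite (branch_through red _ (mid_branch y)).
have sT := through_shortest red (a y) y; set T := through L (a y) y in mT sT.
have ET : T = rcons (take (index (mid y) T) T) (mid y) ++ drop (index (mid y) T).+1 T.
  have ED := drop_nth (mid y) (etrans (index_mem (mid y) T) mT).
  by rewrite nth_index // in ED; rewrite cat_rcons -ED cat_take_drop.
exists (rcons (take (index (mid y) T) T) (mid y)), (drop (index (mid y) T).+1 T).
have inT z : z \in rcons (take (index (mid y) T) T) (mid y) ->
    z \in T /\ index z T <= index (mid y) T.
  rewrite mem_rcons inE => /predU1P[->|zt]; first by rewrite mT.
  by rewrite (mem_take zt) ltnW // -in_take_leq ?index_size ?(mem_take zt).
split.
- by rewrite -ET !ffunE /= (V_blocker_start (VS y)) (V_blocker_target (VS y)).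
- rewrite !ffunE (V_blocker_start (VS y)).
  by have := shortest_walk sT; rewrite {1}ET cat_rcons => /walk_take.
move=> r' ne; apply/negP => /inT[zT zi]; have zy := through_in_gadget red zT.
case: r' ne zT zi zy => [j k|j|y'] ne; rewrite !ffunE.
- rewrite if_same => zT zi zy; have [E1 E2] := lit_start_through zy zT.
  have E : lit j k = (y, a y) by rewrite [lit j k]surjective_pairing E1 E2.
  by have := mid_first E; rewrite -/T ltnNge zi.
- by rewrite if_same => _ _ /gadget_not_room; rewrite ltnNge cla_start_room.
- have yy' : y != y' by apply: contra ne => /eqP->.
  case: ifP => _ _ _ zy; case/eqP: yy'; apply: (var_gadget_inj zy).
    exact: mid_in_gadget.
  by rewrite (V_blocker_start (VS y')) /in_gadget (entrance_col red) leqnn (G_gadgets G).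
Qed.

(** By now all literal and clause agents are in the clause gadgets, and each variable gadget holds
    only its own blocker. *)
Lemma blk_in_phase :
  connect (@step (grid_mapf M)) (conf mid (fun _ _ => true) true)
    (conf (fun y => target M (Blk y)) (fun _ _ => true) true).
Proof.
pose l : seq (agent phi) := map (@Blk phi) (enum 'I_(nvar phi)).
have Blk_inj : injective (@Blk phi) by move=> ? ? [].
have Ul : uniq (l : seq (agents (grid_mapf M))) by rewrite map_inj_uniq // enum_uniq.
apply: (@run_seq (grid_mapf M) l _ _ Ul) => [r|l1 r l2 El].
  by rewrite !ffunE; case: r => // y; rewrite mem_map // mem_enum.
have : r \in l by rewrite El mem_cat mem_head orbT.
case/mapP => y _ Er; rewrite Er in El *.
have mT : mid y \in through L (a y) y by rewrite (branch_through red _ (mid_branch y)).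
have sT := through_shortest red (a y) y.
have [p [sp pT]] : exists p, shortest e (mid y) (exit L y) p /\
    {subset p <= through L (a y) y}.
  case/splitPr: mT sT => p1 p2 /shortest_drop sp; exists (mid y :: p2); split=> // z zp.
  by rewrite mem_cat zp orbT.
exists p, [::]; rewrite cats0 !ffunE /= (V_blocker_target (VS y)); split=> //.
  exact: shortest_walk.
move=> r' ne; apply/negP => /pT/(through_in_gadget red).
case: r' ne => [j k|j|y'] ne; rewrite !ffunE.
- by rewrite if_same => zy; apply: var_not_clause zy (lit_target_in red j k).
- by rewrite if_same => zy; apply: var_not_clause zy (cla_target_in red j).
- have yy' : y != y' by apply: contra ne => /eqP->.
  case: ifP => _ zy; case/eqP: yy'; apply: (var_gadget_inj zy); last exact: mid_in_gadget.
  by rewrite (V_blocker_target (VS y')) /in_gadget (exit_col red) leqnn (G_gadgets G).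
Qed.

End Construction.

Lemma plan_of_satisfiable (phi : cnf3) (M : grid phi) (L : layout M) :
  reduction L -> satisfiable phi ->
  exists pi : agents (grid_mapf M) -> nat -> vert (grid_mapf M),
    [/\ motion_plan pi, collision_free pi
      & distance_cost pi (dstar (grid_mapf M))].
Proof.
move=> red [a sat]; case: (red) => G R VS CS.
have /fin_all_exists[mid midP] y : exists v, v \in branch L (a y) y /\
    forall j k, lit j k = (y, a y) ->
      index v (through L (a y) y) < index (start M (Lit j k)) (through L (a y) y).
  by have [v [vb _ vfirst]] := V_empty (VS y) (a y); exists v.
have mid_branch y := proj1 (midP y); have mid_first y := proj2 (midP y).
apply: (@plan_of_schedule (grid_mapf M)); first exact: G_start_inj G.
have -> : [ffun r => source r] =
    conf (fun y => start M (Blk y)) (fun _ _ => false) false :> {ffun agents (grid_mapf M) -> _}.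
  by apply/ffunP; case=> *; rewrite !ffunE.
have -> : [ffun r => goal r] =
    conf (fun y => target M (Blk y)) (fun _ _ => true) true :> {ffun agents (grid_mapf M) -> _}.
  by apply/ffunP; case=> *; rewrite !ffunE.
apply: connect_trans (blk_out_phase red mid_branch mid_first) _.
apply: connect_trans (blk_in_phase red mid_branch).
(* Without clauses there is no leftmost clause gadget, but then there are no literal or clause
   agents to move either. *)
case: (pickP (fun _ : 'I_(ncl phi) => true)) => [j _|no_clause].
  have [j0 min_j0] := first_clause L j.
  exact (traffic_phases red mid_branch mid_first min_j0 sat).
suff -> : conf (M := M) mid (fun _ _ => false) false = conf mid (fun _ _ => true) true by [].
by apply/ffunP; case=> [j k|j|y]; rewrite !ffunE //; have := no_clause j.
Qed.

Theorem theorem2 (phi : cnf3) (M : grid phi) (L : layout M) :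
  reduction L ->
  ((exists pi : agents (grid_mapf M) -> nat -> vert (grid_mapf M),
      [/\ motion_plan pi, collision_free pi
        & distance_cost pi (dstar (grid_mapf M))])
   <-> satisfiable phi).
Proof.
by move=> red; split; [exact (satisfiable_of_plan red) | exact (plan_of_satisfiable red)].
Qed.
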